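(* Let $n\ge2$ and consider the map $$f:\mathrm{FM}_2(n)\to\mathrm{XAH}_n,\qquad \bigl((\alpha_{ij})_{1\le i<j\le n},(\beta^{ik}_{ij},\alpha^{ik}_{ij})\bigr)\mapsto\bigl((\overline{\alpha_{ij}})_{1\le i<j\le n},[(\beta^{ik}_{ij},\alpha^{ik}_{ij})]\bigr),$$ where $\overline{\alpha_{ij}}=\alpha_{ij}\bmod\pi$ and $[(\beta^{ik}_{ij},\alpha^{ik}_{ij})]$ is the class in the Klein bottle $K^{ik}_{ij}$. Fix $x\in\mathrm{XAH}_n$ and let $m$ be the number of ratios $\beta^{ik}_{ij}$ occurring in $\mathbf{Dom}_n(x)$ such that $\beta^{ik}_{ij}(x)=0$. Then $$|f^{-1}(x)|=2^{m+1}.$$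
   Context: Let $\mathrm{CONF}_n$ be the set of $n$-tuples of pairwise distinct points of $\mathbb{R}^2$ and $\mathbf{conf}_n$ its quotient by translations and positive scalings. For distinct $p_i,p_j$ let $\alpha_{ij}\in\mathbb{R}/2\pi\mathbb{Z}$ be the argument of $p_j-p_i$; for three distinct points let $\beta^{ik}_{ij}=\frac{|p_i-p_k|}{|p_i-p_j|}$, $\alpha^{ik}_{ij}=\alpha_{ik}-\alpha_{ij}\in\mathbb{R}/2\pi\mathbb{Z}$, and $h^{ik}_{ij}=(\beta^{ik}_{ij},\alpha^{ik}_{ij})$ (a hook). $\mathrm{FM}_2(n)$ is the closure of the image of $\mathbf{conf}_n$ in $(\mathbb{R}/2\pi\mathbb{Z})^{\binom n2}\times[0,\infty]^{6\binom n3}$ under $[(p_1,\dots,p_n)]\mapsto((\alpha_{ij})_{i<j},(\beta^{ik}_{ij})_{i,j,k})$, with $i,j,k$ running over ordered triples of pairwise distinct labels. On $\mathrm{FM}_2(n)$ one sets $\alpha_{ji}=\alpha_{ij}+\pi$ and $\alpha^{ik}_{ij}=\alpha_{ik}-\alpha_{ij}$, so its elements are written as $((\alpha_{ij}),(\beta^{ik}_{ij},\alpha^{ik}_{ij}))$. Let $\mathbb{P}^1=\mathbb{R}\cup\{\infty\}$ and let $\sim_k$ identify $(\beta,\alpha)$ with $(-\beta,\alpha+\pi)$ on $\mathbb{P}^1\times\mathbb{R}/2\pi\mathbb{Z}$ (with $-\infty=\infty$); the quotient is a Klein bottle, denoted $K^{ik}_{ij}$ for the triple $(i,j,k)$. Let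 $\mathrm{AH}_n=(\mathbb{R}/\pi\mathbb{Z})^{\binom n2}\times\prod_{(i,j,k)}K^{ik}_{ij}$, and let $\mathrm{XAH}_n$ be the closure in $\mathrm{AH}_n$ of the image of $\mathbf{conf}_n$ under $[(p_1,\dots,p_n)]\mapsto((\alpha_{ij}\bmod\pi)_{i<j},([h^{ik}_{ij}])_{i,j,k})$. For $x\in \mathrm{XAH}_n$ the coordinate $\beta^{ik}_{ij}(x)$ is defined up to sign; $|\beta^{ik}_{ij}(x)|\in[0,\infty]$. Clusters of $x\in\mathrm{XAH}_n$: for $i\neq j$ let $C_{ij}=\{k\neq i,j:|\beta^{ij}_{ik}(x)|>0\}\cup\{i,j\}$, and let $\mathcal C(x)=\{C_{ij}\}_{i<j}\cup\{\{1\},\dots,\{n\}\}$. This is a family of subsets of $[n]=\{1,\dots,n\}$ containing $[n]$ in which any two members are disjoint or one contains the other. A cluster $M\in\mathcal C(x)$ is a maximal subcluster of $S\in\mathcal C(x)$ if $M\subsetneq S$ and no cluster lies strictly between them. $\mathbf{Dom}_n(x)$ is the factor (subproduct) of $\mathrm{AH}_n$ consisting of the circle factors of the angles and the Klein bottle factors of the hooks selected as follows. For each cluster $S$ with at least two elements, let $j_1<j_2<\dots<j_r$ be the minimal labels of its maximal subclusters. (a) If $S=[n]$, select the angle $\alpha_{1j_2}$. (b) If $S\ne[n]$, let $T$ be the cluster having $S$ as a maximal subcluster and let $i_1<i_2<\cdots$ be the minimal labels of the maximal subclusters of $T$; if $j_1>i_1$ select the hook $h^{j_1j_2}_{j_1i_1}$,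 and if $j_1=i_1$ select the hook $h^{j_1j_2}_{j_1i_2}$. (c) For every $t$ with $3\le t\le r$ select the hook $h^{j_1j_t}_{j_1j_2}$. The ratios occurring in $\mathbf{Dom}_n(x)$ are the ratios of the selected hooks. *)

(* Defs.v *)
From HB Require Import structures.
From mathcomp Require Import all_boot all_order all_algebra.
From mathcomp Require Import ring lra.
From mathcomp Require Import generic_quotient ring_quotient.
From mathcomp Require Import all_classical all_reals all_analysis.

Set Implicit Arguments.
Unset Strict Implicit.
Unset Printing Implicit Defensive.

Import Order.TTheory GRing.Theory Num.Theory.
Import numFieldNormedType.Exports.

Local Open Scope classical_set_scope.
Local Open Scope ring_scope.
Local Open Scope quotient_scope.

Section Circle.
Variable R : realType.

Definition zmultiples (c : R) : {pred R} :=
  [pred x | `[< exists k : int, x = k%:~R * c >]].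

Fact zmultiples_zmod_closed (c : R) : zmod_closed (zmultiples c).
Proof.
split=> [|x y]; first by apply/asboolP; exists 0%Z; rewrite mul0r.
move=> /asboolP[k ->] /asboolP[l ->]; apply/asboolP.
by exists (k - l); rewrite rmorphB mulrBl.
Qed.

HB.instance Definition _ (c : R) :=
  GRing.isZmodClosed.Build R (zmultiples c) (zmultiples_zmod_closed c).

(* The topological group R/cZ, with the quotient topology. *)
Definition Rmod (c : R) : Type := quotient_topology {ideal_quot (zmultiples c)}.

HB.instance Definition _ (c : R) := Topological.on (Rmod c).
HB.instance Definition _ (c : R) :=
  GRing.Zmodule.copy (Rmod c) {ideal_quot (zmultiples c)}.
HB.instance Definition _ (c : R) :=
  Quotient.copy (Rmod c) {ideal_quot (zmultiples c)}.

Definition circle : Type := Rmod (2 * pi).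
Definition half_circle : Type := Rmod pi.

HB.instance Definition _ := Topological.on circle.
HB.instance Definition _ := GRing.Zmodule.on circle.
HB.instance Definition _ := Quotient.on circle.
HB.instance Definition _ := Topological.on half_circle.
HB.instance Definition _ := GRing.Zmodule.on half_circle.
HB.instance Definition _ := Quotient.on half_circle.

Definition cpi : circle := \pi_circle pi.

(* The projection R/2piZ -> R/piZ. *)
Definition mod_pi (a : circle) : half_circle := \pi_half_circle (repr a).

Lemma RmodD (c x y : R) :
  \pi_(Rmod c) (x + y) = \pi_(Rmod c) x + \pi_(Rmod c) y.
Proof. exact: (@pi_addr _ _ _ _ _ {ideal_quot (zmultiples c)}). Qed.

Lemma RmodN (c x : R) : \pi_(Rmod c) (- x) = - \pi_(Rmod c) x.
Proof. exact: (@pi_oppr _ _ _ _ _ {ideal_quot (zmultiples c)}). Qed.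

Lemma Rmod0 (c : R) : \pi_(Rmod c) 0 = 0.
Proof. by apply: (@addrI _ (\pi_(Rmod c) 0)); rewrite -RmodD !addr0. Qed.

Lemma RmodP (c x y : R) :
  reflect (exists k : int, x - y = k%:~R * c)
          (\pi_(Rmod c) x == \pi_(Rmod c) y).
Proof.
have -> : (\pi_(Rmod c) x == \pi_(Rmod c) y) = (x - y \in zmultiples c).
  rewrite (@Quotient.idealrBE _ (zmultiples c)).
  by apply/eqP/eqP.
exact: asboolP.
Qed.

Lemma cpiD : cpi + cpi = 0.
Proof.
rewrite -[LHS](@RmodD (2 * pi)) -[RHS](@Rmod0 (2 * pi)).
apply/eqP/RmodP; exists 1%Z.
by rewrite subr0 mul1r mulr_natl mulr2n.
Qed.

(* [None] is the point oo. *)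
Definition P1 : Type := one_point_compactification R.

HB.instance Definition _ := Topological.on P1.

Definition P1_opp (b : P1) : P1 := omap -%R b.

Definition hook : Type := (P1 * circle)%type.

HB.instance Definition _ := Topological.on hook.

Definition hook_flip (h : hook) : hook := (P1_opp h.1, h.2 + cpi).

Definition hook_eq : rel hook := fun h h' => (h' == h) || (h' == hook_flip h).

Lemma hook_flipK : involutive hook_flip.
Proof.
move=> [b a]; rewrite /hook_flip /= -addrA cpiD addr0; congr pair.
by case: b => //= r; rewrite opprK.
Qed.

Fact hook_eq_equiv : equiv_class_of hook_eq.
Proof.
split=> [h|h h'|h2 h1 h3]; rewrite /hook_eq ?eqxx //.
  apply/orP/orP => -[/eqP->|/eqP->]; rewrite ?eqxx ?hook_flipK ?eqxx;
    by [left|right].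
by move=> /orP[/eqP->|/eqP->] /orP[/eqP->|/eqP->];
  rewrite ?hook_flipK ?eqxx ?orbT.
Qed.

Canonical hook_equiv := EquivRelPack hook_eq_equiv.
Canonical hook_encModRel := defaultEncModRel hook_eq.

Definition klein : Type := quotient_topology {eq_quot hook_eq}.

HB.instance Definition _ := Topological.on klein.
HB.instance Definition _ := Quotient.copy klein {eq_quot hook_eq}.

Definition hook_class (h : hook) : klein := \pi_klein h.

Lemma hook_classP h h' : reflect (h' = h \/ h' = hook_flip h)
  (hook_class h == hook_class h').
Proof.
have -> : (hook_class h == hook_class h') = (h == h' %[mod {eq_quot hook_eq}]).
  by apply/eqP/eqP.
rewrite eqmodE.
by apply: (iffP orP) => -[/eqP|/eqP]; tauto.
Qed.

Definition P1_norm (b : P1) : \bar R :=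
  if b is Some r then `|r|%:E else +oo%E.

(* The absolute value of the ratio; it does not depend on the representative. *)
Definition abs_ratio (h : klein) : \bar R := P1_norm (repr h).1.

Lemma abs_ratio_class h : abs_ratio (hook_class h) = P1_norm h.1.
Proof.
have /hook_classP : hook_class (repr (hook_class h)) == hook_class h.
  by rewrite /hook_class reprK.
rewrite /abs_ratio; move: (repr _) => g -[->//|->].
by case: g => -[r|] a //=; rewrite normrN.
Qed.

Definition halfline : Type := [set b : \bar R | (0 <= b)%E].

HB.instance Definition _ := Topological.on halfline.

Definition halfline_of (r : R) (r0 : 0 <= r) : halfline :=
  exist _ r%:E (mem_set (r0 : [set b : \bar R | (0 <= b)%E] r%:E)).

Definition P1_of_halfline (b : halfline) : P1 :=
  if val b is r%:E then Some r else None.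

Definition plane : Type := (R * R)%type.

HB.instance Definition _ := GRing.Zmodule.on plane.

(* The library's norm on a product is the sup norm. *)
Definition enorm (v : plane) : R := Num.sqrt (v.1 ^+ 2 + v.2 ^+ 2).

Definition real_arg (v : plane) : R :=
  if 0 <= v.2 then acos (v.1 / enorm v) else - acos (v.1 / enorm v).

Definition arg (v : plane) : circle := \pi_circle (real_arg v).

Lemma enorm_gt0 v : v != 0 -> 0 < enorm v.
Proof.
move: v => [a b]; rewrite -[_ == _]/((a == 0) && (b == 0)) negb_and sqrtr_gt0.
by move=> /orP[a0|b0]; [apply: ltr_wpDr|apply: ltr_wpDl];
  rewrite ?sqr_ge0// exprn_even_gt0.
Qed.

Lemma enormN v : enorm (- v) = enorm v.
Proof. by rewrite /enorm /= !sqrrN. Qed.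

Lemma enorm_sqr v : enorm v ^+ 2 = v.1 ^+ 2 + v.2 ^+ 2.
Proof. by rewrite sqr_sqrtr// addr_ge0// sqr_ge0. Qed.

Lemma enorm_itv v : v != 0 -> -1 <= v.1 / enorm v <= 1.
Proof.
move=> /enorm_gt0 v0; rewrite -ler_norml normrM normfV (gtr0_norm v0).
rewrite ler_pdivrMr// mul1r -(@ler_pXn2r _ 2%N) ?nnegrE ?(ltW v0)//.
by rewrite enorm_sqr real_normK ?num_real// lerDl sqr_ge0.
Qed.

Section Labels.
(* The labels 1, ..., n are the ordinals 0, ..., n - 1. *)
Variable n : nat.

Definition pair_idx : Type := {p : 'I_n * 'I_n | (p.1 < p.2)%N}.

HB.instance Definition _ := Finite.on pair_idx.

(* [(i, j, k)] is the index of the hook h^{ik}_{ij}. *)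
Definition triple_idx : Type :=
  {t : 'I_n * 'I_n * 'I_n |
     [&& t.1.1 != t.1.2, t.1.1 != t.2 & t.1.2 != t.2]}.

HB.instance Definition _ := Finite.on triple_idx.

Definition FM_ambient : Type :=
  ({ptws pair_idx -> circle} * {ptws triple_idx -> halfline})%type.

HB.instance Definition _ := Topological.on FM_ambient.

Definition AH : Type :=
  ({ptws pair_idx -> half_circle} * {ptws triple_idx -> klein})%type.

HB.instance Definition _ := Topological.on AH.

Definition CONF : set ('I_n -> plane) := [set p : 'I_n -> plane | injective p].

Implicit Types (p : 'I_n -> plane) (i j k : 'I_n).

Definition alpha p i j : circle := arg (p j - p i).

(* beta^{ik}_{ij} *)
Definition beta p i j k : R := enorm (p i - p k) / enorm (p i - p j).

Fact beta_ge0 p i j k : 0 <= beta p i j k.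
Proof. by rewrite divr_ge0 ?sqrtr_ge0. Qed.

(* h^{ik}_{ij} *)
Definition conf_hook p i j k : hook :=
  (Some (beta p i j k), alpha p i k - alpha p i j).

Definition FM_emb p : FM_ambient :=
  (fun e => alpha p (val e).1 (val e).2,
   fun t => halfline_of (beta_ge0 p (val t).1.1 (val t).1.2 (val t).2)).

Definition AH_emb p : AH :=
  (fun e => mod_pi (alpha p (val e).1 (val e).2),
   fun t => hook_class (conf_hook p (val t).1.1 (val t).1.2 (val t).2)).

Definition FM : set FM_ambient := closure (FM_emb @` CONF).

Definition XAH : set AH := closure (AH_emb @` CONF).

(* alpha_ij for all i <> j, through alpha_ji = alpha_ij + pi; the value for
   i = j is never used. *)
Definition FM_angle (y : FM_ambient) i j : circle :=
  if insub (i, j) is Some e then y.1 e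
  else if insub (j, i) is Some e then y.1 e + cpi else 0.

Definition FM_hook (y : FM_ambient) (t : triple_idx) : hook :=
  let: (i, j, k) := val t in
  (P1_of_halfline (y.2 t), FM_angle y i k - FM_angle y i j).

Definition FM_AH (y : FM_ambient) : AH :=
  (fun e => mod_pi (y.1 e), fun t => hook_class (FM_hook y t)).

End Labels.
End Circle.

Arguments FM : clear implicits.
Arguments XAH : clear implicits.

Section Theory.
Variable R : realType.
Implicit Type v : plane R.

Lemma real_argP v : v != 0 ->
  v = (enorm v * cos (real_arg v), enorm v * sin (real_arg v)).
Proof.
move=> v0; have n0 := enorm_gt0 v0.
have cE : enorm v * cos (real_arg v) = v.1.
  have -> : cos (real_arg v) = v.1 / enorm v.
    by rewrite /real_arg; case: ifP => _; rewrite ?cosN acosK ?in_itv ?enorm_itv.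
  by rewrite mulrCA divff ?mulr1// gt_eqF.
have sE : enorm v * sin (acos (v.1 / enorm v)) = `|v.2|.
  rewrite sin_acos ?enorm_itv// -[X in X * _](gtr0_norm n0) -(sqrtr_sqr (enorm v)).
  rewrite -sqrtrM ?sqr_ge0// mulrBr mulr1 expr_div_n mulrCA divff ?mulr1.
    by rewrite enorm_sqr addrC addKr sqrtr_sqr.
  by rewrite expf_neq0// gt_eqF.
have -> : enorm v * sin (real_arg v) = v.2.
  rewrite /real_arg; case: ifP => v2; first by rewrite sE ger0_norm.
  by rewrite sinN mulrN sE ltr0_norm ?opprK// ltNge v2.
by rewrite cE; case: v {v0 n0 cE sE}.
Qed.

Lemma argN v : v != 0 -> arg (- v) = arg v + cpi R.
Proof.
move=> v0; rewrite /arg -[RHS](@RmodD R (2 * pi)); apply/eqP/RmodP.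
rewrite /real_arg enormN /= mulNr acosN ?enorm_itv// oppr_ge0.
case: ltgtP => [v2|v2|v2].
- by exists 0%Z; ring.
- exists (-1); rewrite mulrN1z; ring.
- have [v1|v1] : v.1 / enorm v = 1 \/ v.1 / enorm v = -1.
    have : v.1 != 0.
      apply: contra v0 => /eqP v1; rewrite -[_ == _]/((v.1 == 0) && (v.2 == 0)).
      by rewrite v1 v2 eqxx.
    rewrite /enorm v2 expr0n addr0 sqrtr_sqr => v1.
    have [v1p|v1n] := leP 0 v.1; [left|right].
      by rewrite ger0_norm// divff.
    by rewrite ltr0_norm// invrN mulrN divff.
  + exists 0%Z; rewrite v1 acos1; ring.
  + exists (-1); rewrite mulrN1z v1 acosN1; ring.
Qed.

(* Both maps are invariant under translations and positive scalings, so the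
   image of [CONF] is the image of its quotient conf. *)
Lemma conf_invariant n (p : 'I_n -> plane R) (c : R) (v : plane R) : 0 < c ->
  let q i := (c * (p i).1 + v.1, c * (p i).2 + v.2) in
  FM_emb q = FM_emb p /\ AH_emb q = AH_emb p.
Proof.
move=> c0 q.
have qB i j : q i - q j = (c * (p i - p j).1, c * (p i - p j).2) :> plane R.
  by rewrite -[LHS]/((_ - _, _ - _)); congr pair => /=; ring.
have nE (w : plane R) : enorm (c * w.1, c * w.2) = c * enorm w.
  rewrite /enorm /= !exprMn -mulrDr sqrtrM ?sqr_ge0// sqrtr_sqr gtr0_norm//.
have aE i j : alpha q i j = alpha p i j.
  rewrite /alpha qB; congr (\pi_(circle R) _).
  rewrite /real_arg nE /= pmulr_rge0// invfM.
  rewrite [c * _ * _]mulrACA divff ?mul1r// gt_eqF//.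
have bE i j k : beta q i j k = beta p i j k.
  rewrite /beta !qB !nE invfM mulrACA divff ?mul1r// gt_eqF//.
split; congr pair; apply/funext => t.
- exact: aE.
- by apply: val_inj; rewrite /= bE.
- by rewrite /= aE.
- by rewrite /conf_hook bE !aE.
Qed.

Lemma FM_angle_emb n (p : 'I_n -> plane R) i j : CONF p -> i != j ->
  FM_angle (FM_emb p) i j = alpha p i j.
Proof.
move=> pP ij; rewrite /FM_angle.
case: insubP => [e _ eE|]; first by rewrite /= eE.
move=> /= nij; case: insubP => [e _ eE|] /=; last first.
  by move: ij nij; rewrite -val_eqE /=; case: ltngtP.
rewrite eE /= /alpha -[in RHS]opprB argN// subr_eq0.
by apply: contra ij => /eqP/pP->.
Qed.

Lemma FM_AH_emb n (p : 'I_n -> plane R) : CONF p -> FM_AH (FM_emb p) = AH_emb p.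
Proof.
move=> pP; congr pair; apply/funext => -[[[i j] k] tP].
case/and3P: (tP) => /= ij ik jk.
by rewrite /FM_hook /= !FM_angle_emb.
Qed.

Lemma quot_open (c : R) (U : set R) : open U -> open (\pi_(Rmod c) @` U).
Proof.
move=> oU; rewrite -[open _]/(open (\pi_(Rmod c) @^-1` (\pi_(Rmod c) @` U))).
have -> : \pi_(Rmod c) @^-1` (\pi_(Rmod c) @` U) =
    \bigcup_(k : int) ((fun x => x - k%:~R * c) @^-1` U).
  apply/seteqP; split => [x [y Uy /eqP/RmodP[k yx]]|x [k _ Ux]] /=.
    by exists (- k) => //=; rewrite mulrNz mulNr -yx opprK addrC subrK.
  exists (x - k%:~R * c) => //; apply/eqP/RmodP; exists (- k).
  by rewrite mulrNz; ring.
apply: bigcup_open => k _; apply: open_comp => // x _.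
by apply: cvgB; [exact: cvg_id|exact: cvg_cst].
Qed.

Lemma RmodB_continuous (c : R) :
  continuous (fun a : Rmod c * Rmod c => a.1 - a.2).
Proof.
move=> [a b] U /=; rewrite nbhsE => -[V [oV Vab] VU].
have oV' : open (\pi_(Rmod c) @^-1` V) by [].
have : nbhs (repr a - repr b) (\pi_(Rmod c) @^-1` V).
  by apply: open_nbhs_nbhs; split; rewrite //= RmodD RmodN !reprK.
move=> /(@cvgB _ _ _ (nbhs (repr a, repr b)) _ fst snd (repr a) (repr b) cvg_fst cvg_snd).
move=> [[A B] /= [nA nB] AB].
have : nbhs (repr a) A by [].
rewrite nbhsE => -[A' [oA' A'a] A'A].
have : nbhs (repr b) B by [].
rewrite nbhsE => -[B' [oB' B'b] B'B].
exists (\pi_(Rmod c) @` A', \pi_(Rmod c) @` B').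
  split; apply: open_nbhs_nbhs; split; try exact: quot_open.
    by exists (repr a) => //; rewrite reprK.
  by exists (repr b) => //; rewrite reprK.
move=> [_ _] /= [[x A'x <-] [y B'y <-]]; apply: VU.
rewrite -RmodN -RmodD; apply: (AB (x, y)); split; [exact: A'A|exact: B'B].
Qed.

Lemma P1_of_halfline_continuous : continuous (@P1_of_halfline R).
Proof.
move=> b U nU.
pose g (e : \bar R) : P1 R := if e is s%:E then Some s else None.
suff : nbhs (val b) [set e | U (g e)].
  exact: (@initial_continuous (halfline R) (\bar R) val b).
have b0 : (0 <= val b)%E by have := valP b; rewrite inE.
move: nU; rewrite -[P1_of_halfline b]/(g (val b)).
case: (val b) b0 => [r _ nU|_|//].
  exact: (iffRL (@nbhs_EFin R (fun e => U (g e)) r)).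
move=> [C [cC clC] CU]; have [M [_ CM]] := compact_bounded cC.
apply: filterS (ereal_nbhs_pinfty_gt (num_real (M + 1))) => -[s||] Ms //=;
  last by apply: CU; right.
apply: CU; left; exists s => // Cs.
have /= := CM (M + 1) _ _ Cs; rewrite ltrDl ltr01 => /(_ isT).
by rewrite lte_fin in Ms; rewrite leNgt (lt_le_trans Ms) ?ler_norm.
Qed.

Lemma mod_pi_continuous : continuous (@mod_pi R).
Proof.
apply: (@repr_comp_continuous _ {ideal_quot (zmultiples (2 * pi : R))} _ (\pi_(half_circle R))).
  exact: (@pi_continuous R {ideal_quot (zmultiples (pi : R))}).
move=> x y /(@RmodP _ (2 * pi)) [k kE]; apply/(@RmodP _ pi); exists (k * 2).
by rewrite kE intrM mulrA.
Qed.

Lemma ptws_continuous (T : topologicalType) (I : Type) (U : topologicalType)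
   (g : T -> {ptws I -> U}) :
  (forall i, continuous (fun x => g x i)) -> continuous g.
Proof.
move=> gc x; apply/cvg_sup => i V [_ [[W oW <-] Wx WV]].
apply: (filterS WV); apply: (gc i x W).
exact: open_nbhs_nbhs.
Qed.

Lemma pair_continuous (T U V : topologicalType) (f : T -> U) (g : T -> V) :
  continuous f -> continuous g -> continuous (fun x => (f x, g x)).
Proof. by move=> cf cg x; apply: (cvg_pair (cf x) (cg x)). Qed.

Lemma FM_angle_continuous n (i j : 'I_n) :
  continuous (fun y : FM_ambient R n => FM_angle y i j).
Proof.
have pc e : continuous (fun y : FM_ambient R n => y.1 e).
  move=> y; apply: (@continuous_comp _ _ _ fst (fun a : {ptws _ -> _} => a e)).
    exact: cvg_fst.
  exact: (@proj_continuous _ (fun _ => circle R)).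
rewrite /FM_angle; case: insubP => [e _ _|_]; first exact: pc.
case: insubP => [e _ _|_]; last by move=> y; exact: cvg_cst.
move=> y.
have -> : (fun y : FM_ambient R n => y.1 e + cpi R) =
  (fun ab : circle R * circle R => ab.1 - ab.2) \o (fun y : FM_ambient R n => (y.1 e, - cpi R)).
  by apply/funext => z /=; rewrite opprK.
apply: continuous_comp; last exact: (@RmodB_continuous (2 * pi)).
by apply: pair_continuous; [exact: pc|move=> ?; exact: cvg_cst].
Qed.

Lemma FM_AH_continuous n : continuous (@FM_AH R n).
Proof.
apply: pair_continuous.
  apply: (@ptws_continuous (FM_ambient R n) _ _ (fun y e => mod_pi (y.1 e))) => e z.
  apply: (@continuous_comp _ _ _ (fun y : FM_ambient R n => y.1 e)); last exact: mod_pi_continuous.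
  apply: (@continuous_comp _ _ _ fst (fun a : {ptws _ -> _} => a e)).
    exact: cvg_fst.
  exact: (@proj_continuous _ (fun _ => circle R)).
apply: (@ptws_continuous (FM_ambient R n) _ _ (fun y t => hook_class (FM_hook y t))) => t z.
apply: (@continuous_comp _ _ _ (fun y : FM_ambient R n => FM_hook y t)); last first.
  exact: (@pi_continuous _ {eq_quot @hook_eq R}).
rewrite /FM_hook; case tE: (val t) => [[i j] k].
apply: (pair_continuous (f := fun y : FM_ambient R n => P1_of_halfline (y.2 t)) (g := fun y => FM_angle y i k - FM_angle y i j)) => {}z.
  apply: (@continuous_comp _ _ _ (fun y : FM_ambient R n => y.2 t)); last first.
    exact: P1_of_halfline_continuous.
  apply: (@continuous_comp _ _ _ snd (fun a : {ptws _ -> _} => a t)).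
    exact: cvg_snd.
  exact: (@proj_continuous _ (fun _ => halfline R)).
apply: (@continuous_comp _ _ _ (fun y => (FM_angle y i k, FM_angle y i j)) (fun ab : circle R * circle R => ab.1 - ab.2)); last exact: (@RmodB_continuous (2 * pi)).
by apply: pair_continuous; exact: FM_angle_continuous.
Qed.

Lemma FM_AH_XAH n y : FM R n y -> XAH R n (FM_AH y).
Proof.
move=> Fy U /FM_AH_continuous /Fy [_ [[p pC <-] Up]].
by exists (FM_AH (FM_emb p)); split=> //; exists p => //; rewrite FM_AH_emb.
Qed.

End Theory.

Section Statement.
Variables (R : realType) (n : nat).
Implicit Types i j k : 'I_n.

Definition FM_to_XAH (y : FM R n) : XAH R n :=
  exist _ (FM_AH (val y)) (mem_set (FM_AH_XAH (set_mem (valP y)))).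

Section Clusters.
Local Open Scope set_scope.
Variable x : AH R n.
Implicit Types S T M N : {set 'I_n}.

(* [(i, k, j)] is the index of h^{ij}_{ik}. *)
Definition pair_cluster i j : {set 'I_n} :=
  [set k | [exists t : triple_idx n,
     (val t == (i, k, j)) && (0 < abs_ratio (x.2 t))%E]] :|: [set i; j].

Definition clusters : {set {set 'I_n}} :=
  [set pair_cluster (val e).1 (val e).2 | e : pair_idx n]
  :|: [set [set i] | i : 'I_n].

Definition maximal_subcluster M S : bool :=
  [&& M \in clusters, S \in clusters, M \proper S &
      [forall N in clusters, ~~ ((M \proper N) && (N \proper S))]].

(* In increasing order, as is [enum 'I_n]. *)
Definition min_labels S : seq 'I_n :=
  [seq j <- enum 'I_n | [exists M, [&& maximal_subcluster M S, j \in M &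
                                       [forall k in M, (j <= k)%N]]]].

(* Positions are counted from 1. *)
Definition min_label S (r : nat) j : bool :=
  onth (min_labels S) r.-1 == Some j.

Definition selects_angle S (e : pair_idx n) : bool :=
  let: (i, j) := val e in
  [&& S == [set: 'I_n], i == 0 :> nat & min_label S 2 j].

Definition selects_outer_hook S (t : triple_idx n) : bool :=
  let: (j1, i, j2) := val t in
  [&& S != [set: 'I_n], min_label S 1 j1, min_label S 2 j2 &
   [exists T, maximal_subcluster S T &&
    [exists i1, min_label T 1 i1 &&
      if (i1 < j1)%N then i == i1 else (j1 == i1) && min_label T 2 i]]].

Definition selects_inner_hook S (t : triple_idx n) : bool :=
  let: (j1, j2, jr) := val t in
  [&& min_label S 1 j1, min_label S 2 j2 &
      [exists r : 'I_n.+1, (3 <= r)%N && min_label S r jr]].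

(* The subproduct Dom is given by the set of its factors. *)
Definition Dom : {set pair_idx n + triple_idx n} :=
  [set f | [exists S in clusters, (2 <= #|S|)%N &&
    match f with
    | inl e => selects_angle S e
    | inr t => selects_outer_hook S t || selects_inner_hook S t
    end]].

Definition zero_ratios : {set triple_idx n} :=
  [set t | (inr t \in Dom) && (abs_ratio (x.2 t) == 0%E)].

End Clusters.
End Statement.

(* Main.v *)
(* The fibre of f over x is a torsor under sign changes indexed by the clusters
   of x with at least two elements.  A point of the fibre has the same ratios as
   any other, and its angles are known up to pi; the hooks with ratio in
   (0, oo) force the sign changes to agree on pairs spanning the same cluster.
   Conversely every cluster S can be flipped: if configurations p converge to a
   point of the fibre, reflecting the points labelled by S at one of them changes
   p_i - p_j to its opposite for i, j in S, and perturbs p_i - p_j by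
   o(|p_i - p_j|) when only one of i, j lies in S.  These flips are independent,
   so the fibre has 2^N points with N the number of such clusters.  Finally each
   cluster S other than [n] selects exactly one hook with ratio 0, by rule (b),
   and the hooks of rule (c) have nonzero ratios, so that N = m + 1. *)
Require Import Defs.
From mathcomp Require Import all_boot all_order all_algebra.
From mathcomp Require Import ring lra.
From mathcomp Require Import generic_quotient ring_quotient.
From mathcomp Require Import all_classical all_reals all_analysis.

Import Order.TTheory GRing.Theory Num.Theory.
Import numFieldNormedType.Exports.

Set Implicit Arguments.
Unset Strict Implicit.
Unset Printing Implicit Defensive.

Local Open Scope classical_set_scope.
Local Open Scope ring_scope.
Local Open Scope quotient_scope.

(** * Angles *)

Section Angles.
Variable R : realType.
Implicit Types (a b t : R) (v w : plane R).

Lemma cosDz2pi t (k : int) : cos (t - k%:~R * (2 * pi)) = cos t.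
Proof.
have D1 s : cos (s + 2 * pi) = cos s by rewrite mulr_natl cosD2pi.
have Dn m (s : R) : cos (s + m%:R * (2 * pi)) = cos s.
  elim: m s => [|m IH] s; first by rewrite mul0r addr0.
  by rewrite -natr1 mulrDl mul1r addrA D1 IH.
case: k => m; first by rewrite -[t in RHS](subrK (m%:R * (2 * pi))) Dn.
by rewrite NegzE mulrNz mulNr opprK Dn.
Qed.

Lemma sinDz2pi t (k : int) : sin (t - k%:~R * (2 * pi)) = sin t.
Proof.
by rewrite -[t in RHS](subrK (pi / 2)) -[LHS]cosBpihalf addrAC cosDz2pi
  sinDpihalf.
Qed.

Lemma reduce_2pi t : exists k : int, `|t - k%:~R * (2 * pi)| <= pi.
Proof.
have p0 := pi_gt0 R.
exists (Num.floor ((t + pi) / (2 * pi))).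
have := floor_itv ((t + pi) / (2 * pi)).
rewrite ler_pdivlMr ?ltr_pdivrMr ?mulr_gt0//.
set f := Num.floor _; rewrite intrD (mulrDl f%:~R) mul1r.
set z := f%:~R * _ => /andP[z1 z2]; rewrite ler_norml.
by apply/andP; split; lra.
Qed.

(** Cosine is even, periodic and decreasing on [0, pi]. This turns a lower bound on a cosine into
    closeness of an angle to 0 modulo 2 pi. *)
Lemma cos_gt_near_2pi t d : 0 < d -> d <= pi -> cos d < cos t ->
  exists k : int, `|t - k%:~R * (2 * pi)| < d.
Proof.
move=> d0 dpi ct; have [k kP] := reduce_2pi t; exists k.
have kI : `|t - k%:~R * (2 * pi)| \in `[0, pi] by rewrite in_itv/= normr_ge0.
have dI : d \in `[0, pi] by rewrite in_itv/= (ltW d0).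
by rewrite -(ltr_cos kI dI) cos_norm cosDz2pi.
Qed.

(** The hypotheses give cos (a - b) = cos^2 + sin^2 = 1, and on [0, pi] only 0 has cosine 1. *)
Lemma cos_sin_eq_mod_2pi a b : cos a = cos b -> sin a = sin b ->
  exists k : int, a - b = k%:~R * (2 * pi).
Proof.
move=> cE sE; have [k kP] := reduce_2pi (a - b); exists k.
have kI : `|a - b - k%:~R * (2 * pi)| \in `[0, pi].
  by rewrite in_itv/= normr_ge0.
have I0 : 0 \in `[0, pi : R] by rewrite in_itv/= lexx pi_ge0.
apply/eqP; rewrite -subr_eq0 -normr_eq0; apply/eqP/(cos_inj kI I0).
by rewrite cos_norm cosDz2pi cosB cE sE cos0 -!expr2 cos2Dsin2.
Qed.

Lemma cpi_neq0 : cpi R != 0.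
Proof.
apply/negP; rewrite /cpi -[0](@Rmod0 R (2 * pi)) => /(@RmodP _ (2 * pi))[k].
rewrite subr0 mulrA => kE.
have /eqP : (k%:~R * 2 - 1) * pi = 0 :> R by rewrite mulrBl -kE mul1r subrr.
rewrite mulf_eq0 (gt_eqF (pi_gt0 R)) orbF subr_eq0 => /eqP k1.
have : (k * 2)%:~R = 1%:~R :> R by rewrite intrM k1.
by move=> /intr_inj /(congr1 (fun z => (z %% 2)%Z)); rewrite modzMl.
Qed.

Lemma mod_pi_eq (a b : circle R) : mod_pi a = mod_pi b ->
  b = a \/ b = a + cpi R.
Proof.
move=> /eqP /(@RmodP _ pi)[k kE].
have kE2 : k%:~R = (k %/ 2)%Z%:~R * 2 + (k %% 2)%Z%:~R :> R.
  by rewrite [in LHS](divz_eq k 2) intrD intrM.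
(* The representatives differ by k pi; the parity of k decides whether the two classes agree or
   differ by a half turn. *)
have [m0|m1] : (k %% 2)%Z = 0 \/ (k %% 2)%Z = 1.
- have := ltz_pmod k (isT : 0 < 2 :> int); have := modz_ge0 k (isT :
  2 != 0 :> int).
  by case: (k %% 2)%Z => // -[|[|]] // _ _; [left|right].
- left; rewrite -[a]reprK -[b]reprK; apply/eqP/(@RmodP _ (2 * pi)).
  exists (- (k %/ 2)%Z); rewrite mulrNz mulNr mulrA.
  by move: kE; rewrite kE2 m0 addr0 => <-; rewrite opprB.
- right; rewrite -[a]reprK -[b]reprK.
  rewrite /cpi -[_ + _](@RmodD R (2 * pi)); apply/eqP/(@RmodP _ (2 * pi)).
  exists (- (k %/ 2)%Z - 1); rewrite intrB mulrNz mulrBl mulNr mulrA.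
  move: kE; rewrite kE2 m1 mulrDl => /eqP; rewrite -subr_eq => /eqP <-; ring.
Qed.

Lemma mod_piDpi (a : circle R) : mod_pi (a + cpi R) = mod_pi a.
Proof.
rewrite -[a in LHS]reprK /cpi -[X in mod_pi X](@RmodD R (2 * pi)).
apply/eqP/(@RmodP _ pi).
have /eqP/(@RmodP _ (2 * pi))[k kE] :
  repr (\pi_(circle R) (repr a + pi)) = repr a + pi %[mod circle R].
  by rewrite reprK.
exists (k * 2 + 1); rewrite intrD intrM.
transitivity (k%:~R * (2 * pi) + pi : R); last by ring.
rewrite -kE; ring.
Qed.

(** * Euclidean norm and perturbation of arguments *)

Lemma ler_norm_dot v w : `|v.1 * w.1 + v.2 * w.2| <= enorm v * enorm w.
Proof.
rewrite -(@ler_pXn2r _ 2%N) ?nnegrE ?mulr_ge0 ?sqrtr_ge0//.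
rewrite real_normK ?num_real// exprMn !enorm_sqr -subr_ge0.
(* Lagrange's identity: the defect in the Cauchy-Schwarz inequality is the square of the
   determinant. *)
by rewrite [leRHS](_ : _ = (v.1 * w.2 - v.2 * w.1) ^+ 2) ?sqr_ge0//; ring.
Qed.

Lemma ler_enormD v w : enorm (v + w) <= enorm v + enorm w.
Proof.
have e0 u : 0 <= enorm u :> R by exact: sqrtr_ge0.
rewrite -(@ler_pXn2r _ 2%N) ?nnegrE ?addr_ge0// sqrrD !enorm_sqr.
have -> : (v + w).1 = v.1 + w.1 by [].
have -> : (v + w).2 = v.2 + w.2 by [].
have /ler_normlP[_ h] := ler_norm_dot v w; lra.
Qed.

Lemma ler_enormB v w : enorm v - enorm w <= enorm (v + w).
Proof. by rewrite lerBlDr -[enorm w]enormN -[v in leLHS](addrK w) ler_enormD.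
  Qed.

(** If |w| <= e |v|, the cosine of the angle between v and v + w is at least (1 - e) / (1 + e), a
    bound independent of v. This uniformity allows v to vary along a filter later. *)
Lemma arg_perturb (U : set (circle R)) : nbhs (0 : circle R) U ->
  exists2 e : R, 0 < e &
    forall v w, v != 0 -> enorm w <= e * enorm v ->
      v + w != 0 /\ U (arg v - arg (v + w)).
Proof.
move=> nU; have : nbhs (0 : R) (\pi_(circle R) @^-1` U).
  apply: (@pi_continuous R {ideal_quot (zmultiples (2 * pi : R))} 0 U).
  by rewrite -[\pi_ _ _]/(\pi_(Rmod (2 * pi : R)) 0) Rmod0.
rewrite -nbhs_ballE => -[d /= d0 dU].
set d' := Num.min d pi.
have d'0 : 0 < d' by rewrite lt_min d0 pi_gt0.
have d'pi : d' <= pi by rewrite ge_min lexx orbT.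
have cd1 : cos d' < 1.
  by rewrite -cos0 ltr_cos// in_itv/= ?lexx ?pi_ge0// ltW.
have cdN1 : -1 <= cos d' by apply: cos_geN1.
(* This value is at most 2/3, so v + w cannot vanish, and it satisfies (1 - e) / (1 + e) > cos
   d'. *)
exists ((1 - cos d') / 3); first lra.
set e := _ / 3 => v w v0 we.
have nv := enorm_gt0 v0.
have eP : e * 3 = 1 - cos d' by rewrite /e mulfVK.
have low := ler_enormB v w; have up := ler_enormD v w.
have nvw : 0 < enorm (v + w).
  apply: lt_le_trans low; rewrite subr_gt0 (le_lt_trans we)//.
  by rewrite gtr_pMl//; lra.
have vw0 : v + w != 0.
  apply: contraTneq nvw => ->.
  by rewrite /enorm /= expr0n addr0 sqrtr0 ltxx.
split=> //.
have [k kP] : exists k : int,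
    `|real_arg v - real_arg (v + w) - k%:~R * (2 * pi)| < d'.
  apply: cos_gt_near_2pi => //; rewrite cosB.
  set X := _ + _.
  (* [X] is the cosine of the angle between v and v + w, so the left side is their dot product. *)
  have XE : enorm v * (enorm (v + w) * X) =
      enorm v ^+ 2 + (v.1 * w.1 + v.2 * w.2).
    have -> : enorm v ^+ 2 + (v.1 * w.1 + v.2 * w.2) =
        v.1 * (v + w).1 + v.2 * (v + w).2.
      rewrite enorm_sqr -[(v + w).1]/(v.1 + w.1) -[(v + w).2]/(v.2 + w.2); ring.
    have /= := congr1 snd (real_argP vw0); have /= :=
      congr1 fst (real_argP vw0).
    have /= := congr1 snd (real_argP v0); have /= := congr1 fst (real_argP v0).
    by move=> -> -> -> ->; rewrite /X; ring.
  have /ler_normlP[dot _] := ler_norm_dot v w.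
  have e0 : 0 < e by lra.
  have h1 : enorm v * (1 - e) <= enorm (v + w) * X.
    rewrite -(ler_pM2l nv) XE.
    have := ler_wpM2l (ltW nv) we; lra.
  have X0 : 0 < X.
    by rewrite -(pmulr_rgt0 _ nvw) (lt_le_trans _ h1)// mulr_gt0//; lra.
  have h2 : enorm v * (1 - e) <= enorm v * ((1 + e) * X).
    apply: (le_trans h1); rewrite mulrA ler_pM2r//; lra.
  rewrite ler_pM2l// in h2.
  have : e * cos d' <= e * 1 by rewrite ler_pM2l// ltW.
  rewrite -(ltr_pM2l (_ : 0 < 1 + e)); lra.
have -> : arg v - arg (v + w) =
    \pi_(circle R) (real_arg v - real_arg (v + w) - k%:~R * (2 * pi)).
  rewrite /arg -(@RmodN R (2 * pi)) -(@RmodD R (2 * pi)).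
  by apply/eqP/(@RmodP _ (2 * pi)); exists k; rewrite opprB addrC subrK.
apply: dU; rewrite /ball /= sub0r normrN (lt_le_trans kP)//.
by rewrite ge_min lexx.
Qed.

End Angles.

(** * Compactness and separation *)

Section Topology.
Variable R : realType.

Lemma cvg_circleB (T : Type) (F : set_system T) {FF : Filter F}
    (f g : T -> circle R) (a b : circle R) :
  f @ F --> a -> g @ F --> b -> (fun t => f t - g t) @ F --> a - b.
Proof.
move=> fa gb.
have fg : (fun t => (f t, g t)) @ F --> (a, b) by exact: (cvg_pair fa gb).
apply: (@cvg_comp _ _ _ _ (fun c : circle R * circle R => c.1 - c.2) _ _ _ fg).
exact: (@RmodB_continuous R (2 * pi) (a,b)).
Qed.

(** Functions on the quotient are written through [repr]; periodicity makes the choice of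
    representative immaterial, and the quotient topology gives continuity. *)
Lemma Rmod_lift_continuous (c : R) (Z : topologicalType) (g : R -> Z) :
  continuous g -> (forall x (k : int), g (x - k%:~R * c) = g x) ->
  continuous (fun a : Rmod c => g (repr a)).
Proof.
move=> gc gP.
apply: (@repr_comp_continuous _ {ideal_quot (zmultiples c)} _ g) => // x y.
move=> /(@RmodP _ c)[k kE]; apply/eqP.
by rewrite -(gP x k) -kE opprB addrC subrK.
Qed.

Lemma Rmod_lift_pi (c : R) (Z : Type) (g : R -> Z) x :
  (forall x (k : int), g (x - k%:~R * c) = g x) ->
  g (repr (\pi_(Rmod c) x)) = g x.
Proof.
move=> gP; have /eqP/(@RmodP _ c)[k kE] :
  repr (\pi_(Rmod c) x) = x %[mod Rmod c] by rewrite reprK.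
by rewrite -(gP _ k) -kE opprB addrC subrK.
Qed.

Definition ccos (a : circle R) : R := cos (repr a).
Definition csin (a : circle R) : R := sin (repr a).

Lemma ccos_continuous : continuous ccos.
Proof.
by apply: (@Rmod_lift_continuous (2 * pi) _ cos);
  [exact: continuous_cos|exact: cosDz2pi].
Qed.

Lemma csin_continuous : continuous csin.
Proof.
by apply: (@Rmod_lift_continuous (2 * pi) _ sin);
  [exact: continuous_sin|exact: sinDz2pi].
Qed.

Lemma ccosDpi a : ccos (a + cpi R) = - ccos a.
Proof.
rewrite /ccos -[a in LHS]reprK /cpi -[X in repr X](@RmodD R (2 * pi)).
by rewrite (@Rmod_lift_pi _ _ cos)// ?cosDpi//; exact: cosDz2pi.
Qed.

Lemma csinDpi a : csin (a + cpi R) = - csin a.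
Proof.
rewrite /csin -[a in LHS]reprK /cpi -[X in repr X](@RmodD R (2 * pi)).
by rewrite (@Rmod_lift_pi _ _ sin)// ?sinDpi//; exact: sinDz2pi.
Qed.

Lemma ccos2Dcsin2 a : ccos a ^+ 2 + csin a ^+ 2 = 1.
Proof. exact: cos2Dsin2. Qed.

Definition P1_fun (g : R -> R) (b : P1 R) : R := if b is Some r then g r else 0.

(** The decay |g(r)| <= 1/|r| makes g tend to 0 at infinity, which is the value that [P1_fun]
    assigns there. Outside the compact interval [-1/e, 1/e] the function is smaller than e. *)
Lemma P1_fun_continuous (g : R -> R) : continuous g ->
  (forall r, `|g r| * `|r| <= 1) -> continuous (P1_fun g).
Proof.
move=> gc gb [r|]; first exact: gc.
have FF : Filter (nbhs (None : P1 R)) := nbhs_filter _.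
apply/(@cvgrPdist_lt _ _ _ _ FF) => e e0.
exists [set` `[- e^-1, e^-1]].
  split; first exact: segment_compact.
  exact: interval_closed.
move=> _ [[r nr <-]|->] /=; last by rewrite subrr normr0.
rewrite sub0r normrN -(@ltr_pM2r _ `|r|).
  rewrite (le_lt_trans (gb r))// -ltr_pdivrMl// mulr1 ltNge.
  by apply/negP => /ler_normlP[r1 r2]; apply: nr;
    rewrite /= in_itv/= r2 lerNl r1.
rewrite normr_gt0; apply: contra_notN nr => /eqP ->.
by rewrite /= in_itv/= invr_ge0 oppr_le0 invr_ge0 (ltW e0).
Qed.

(** * Separation of points by continuous real functions *)

Lemma half_circle_separated (a b : half_circle R) :
  (forall f : half_circle R -> R, continuous f -> f a = f b) -> a = b.
Proof.
move=> H.
(* Doubling the angle makes cosine and sine pi-periodic; together they determine the angle modulo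
   pi. *)
have c2 : continuous (fun x : R => 2 * x) by exact: mulrl_continuous.
have P2 (x : R) (k : int) : 2 * (x - k%:~R * pi) = 2 * x - k%:~R * (2 * pi).
  ring.
have [k] : exists k : int, 2 * repr a - 2 * repr b = k%:~R * (2 * pi).
  apply: cos_sin_eq_mod_2pi.
    apply: (H (fun a => cos (2 * repr a))).
    apply: (@Rmod_lift_continuous pi _ (fun x => cos (2 * x))).
      by move=> x; apply: continuous_comp; [exact: c2|exact: continuous_cos].
    by move=> x k; rewrite P2 cosDz2pi.
  apply: (H (fun a => sin (2 * repr a))).
  apply: (@Rmod_lift_continuous pi _ (fun x => sin (2 * x))).
    by move=> x; apply: continuous_comp; [exact: c2|exact: continuous_sin].
  by move=> x k; rewrite P2 sinDz2pi.
move=> kE; rewrite -[a]reprK -[b]reprK; apply/eqP/(@RmodP _ pi); exists k; lra.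
Qed.

Lemma klein_lift_continuous (Z : topologicalType) (g : hook R -> Z) :
  continuous g -> (forall h, g (hook_flip h) = g h) ->
  continuous (fun h : klein R => g (repr h)).
Proof.
move=> gc gP.
apply: (@repr_comp_continuous _ {eq_quot @hook_eq R} _ g) => // h h'.
by move=> /hook_classP[->|->]; rewrite ?gP.
Qed.

Lemma klein_lift_class (Z : Type) (g : hook R -> Z) h :
  (forall h, g (hook_flip h) = g h) -> g (repr (hook_class h)) = g h.
Proof.
move=> gP; have /hook_classP[->//|->] :
  hook_class h == hook_class (repr (hook_class h)).
  by rewrite /hook_class reprK.
exact: gP.
Qed.

Lemma klein_separated (a b : klein R) :
  (forall f : klein R -> R, continuous f -> f a = f b) -> a = b.
Proof.
move=> H.
have cls (h : klein R) : hook_class (repr h) = h by exact: reprK.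
(* The angle modulo pi is invariant under the flip. After flipping the representative of [b] if
   necessary, the angles agree and only the ratios remain to be compared. *)
have [h' b_h' angle] : exists2 h', hook_class h' = b & h'.2 = (repr a).2.
  have : mod_pi (repr a).2 = mod_pi (repr b).2.
    apply: half_circle_separated => f fc.
    apply: (H (fun h => f (mod_pi (repr h).2))).
    apply: (@klein_lift_continuous _ (fun h => f (mod_pi h.2))).
      move=> h; apply: continuous_comp; last exact: fc.
      by apply: continuous_comp; [exact: cvg_snd|exact: mod_pi_continuous].
    by move=> h; rewrite /= mod_piDpi.
  move=> /mod_pi_eq[E|E]; first by exists (repr b).
  exists (hook_flip (repr b)).
    rewrite -[RHS]cls; apply/eqP/hook_classP; right.
    by rewrite hook_flipK.
  by rewrite /= E -addrA cpiD addr0.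
have Hlift (g : hook R -> R) : continuous g ->
    (forall h, g (hook_flip h) = g h) -> g (repr a) = g h'.
  move=> gc gP; rewrite -(klein_lift_class h' gP) b_h'.
  by apply: (H (fun h => g (repr h))); exact: klein_lift_continuous.
(* u and w = beta * u separate the points of P1, and u, w * cos, w * sin are
   invariant under the flip. *)
pose u := P1_fun (fun r => (1 + r ^+ 2)^-1).
pose w := P1_fun (fun r => r / (1 + r ^+ 2)).
have pos r : 0 < 1 + r ^+ 2 :> R by rewrite ltr_wpDr ?sqr_ge0.
have le1 r : `|r| <= 1 + r ^+ 2 :> R.
  by rewrite -(real_normK (num_real r)); have := sqr_ge0 (`|r| - 1); nra.
have ic : continuous (fun r : R => (1 + r ^+ 2)^-1).
  move=> r; apply: cvgV; first by rewrite gt_eqF.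
  by apply: cvgD; [exact: cvg_cst|exact: exprn_continuous].
have uc : continuous u.
  apply: P1_fun_continuous => // r.
  by rewrite normfV (gtr0_norm (pos r)) mulrC ler_pdivrMr// mul1r.
have wc : continuous w.
  apply: P1_fun_continuous => [r|r].
    by apply: cvgM; [exact: cvg_id|exact: ic].
  rewrite normrM normfV (gtr0_norm (pos r)) mulrAC ler_pdivrMr// mul1r.
  by rewrite -expr2 real_normK ?num_real// lerDr.
have uN c : u (P1_opp c) = u c by case: c => //= r; rewrite sqrrN.
have wN c : w (P1_opp c) = - w c.
  by case: c => [r|] /=; rewrite ?oppr0// sqrrN mulNr.
have c1 (f : P1 R -> R) : continuous f -> continuous (fun h : hook R => f h.1).
  by move=> fc h; apply: continuous_comp; [exact: cvg_fst|exact: fc].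
have c2 (f : circle R -> R) : continuous f -> continuous (fun h : hook R =>
  f h.2).
  by move=> fc h; apply: continuous_comp; [exact: cvg_snd|exact: fc].
have uE : u (repr a).1 = u h'.1.
  by apply: (Hlift (fun h => u h.1)) => [|h]; [exact: c1|exact: uN].
have wcE : w (repr a).1 * ccos (repr a).2 = w h'.1 * ccos h'.2.
  apply: (Hlift (fun h => w h.1 * ccos h.2)) => [h|h].
    by apply: cvgM; [exact: c1|apply: c2; exact: ccos_continuous].
  by rewrite /= wN ccosDpi mulrNN.
have wsE : w (repr a).1 * csin (repr a).2 = w h'.1 * csin h'.2.
  apply: (Hlift (fun h => w h.1 * csin h.2)) => [h|h].
    by apply: cvgM; [exact: c1|apply: c2; exact: csin_continuous].
  by rewrite /= wN csinDpi mulrNN.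
(* The angles being equal, w is recovered as w cos^2 + w sin^2. *)
have wE : w (repr a).1 = w h'.1.
  rewrite -[LHS]mulr1 -[RHS]mulr1 -(ccos2Dcsin2 (repr a).2) !mulrDr !expr2
    !mulrA.
  by rewrite wcE wsE angle.
rewrite -[a]cls -b_h'; congr hook_class.
rewrite [repr a]surjective_pairing [h']surjective_pairing angle; congr pair.
move: uE wE; case: (repr a).1 h'.1 => [r|] [r'|] //=.
- by move=> -> /(mulIf _) ->//; rewrite invr_neq0// gt_eqF.
- by move=> /eqP; rewrite invr_eq0 gt_eqF.
- by move=> /esym/eqP; rewrite invr_eq0 gt_eqF.
Qed.

Lemma AH_separated n (a b : AH R n) :
  (forall f : AH R n -> R, continuous f -> f a = f b) -> a = b.
Proof.
move=> H; rewrite [a]surjective_pairing [b]surjective_pairing.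
congr pair; apply/funext => e.
  apply: half_circle_separated => f fc; apply: (H (fun x => f (x.1 e))) => x.
  apply: (@continuous_comp _ _ _ (fun x : AH R n => x.1 e)); last exact: fc.
  apply: (@continuous_comp _ _ _ fst (fun a : {ptws _ -> _} => a e)).
    exact: cvg_fst.
  exact: (@proj_continuous _ (fun _ => half_circle R)).
apply: klein_separated => f fc; apply: (H (fun x => f (x.2 e))) => x.
apply: (@continuous_comp _ _ _ (fun x : AH R n => x.2 e)); last exact: fc.
apply: (@continuous_comp _ _ _ snd (fun a : {ptws _ -> _} => a e)).
  exact: cvg_snd.
exact: (@proj_continuous _ (fun _ => klein R)).
Qed.

(** * Compactness of the ambient space and surjectivity *)

Lemma cvg_halfline (T : Type) (F : set_system T) {FF : Filter F}
    (g : T -> halfline R) (b : halfline R) :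
  (fun t => val (g t)) @ F --> val b -> g @ F --> b.
Proof.
move=> gb U [_ [[V oV <-] Vb VU]]; apply: (filterS VU).
by apply: (gb V); exact: open_nbhs_nbhs.
Qed.

Lemma circle_compact : compact [set: circle R].
Proof.
have -> : [set: circle R] = \pi_(circle R) @` [set` `[- pi, pi]].
  apply/seteqP; split => // a _.
  have [k kP] := reduce_2pi (repr a).
  exists (repr a - k%:~R * (2 * pi)); first by rewrite /= in_itv/= -ler_norml.
  rewrite -[RHS]reprK; apply/eqP/(@RmodP _ (2 * pi)); exists (- k).
  by rewrite mulrNz; ring.
apply: continuous_compact; last exact: segment_compact.
by apply: continuous_subspaceT; exact:
  (@pi_continuous R {ideal_quot (zmultiples (2 * pi : R))}).
Qed.

Fact P1_norm_ge0 (b : P1 R) : (0 <= P1_norm b)%E.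
Proof. by case: b => [r|] //=; rewrite lee_fin. Qed.

(** The absolute value as a map from the compact space [P1] onto [0, oo]; its continuity transports
    compactness to [halfline]. *)
Definition halfline_of_P1 (b : P1 R) : halfline R :=
  exist _ (P1_norm b) (mem_set (P1_norm_ge0 b : [set c :
    \bar R | (0 <= c)%E] _)).

Lemma halfline_of_P1_continuous : continuous halfline_of_P1.
Proof.
move=> b; apply: (@cvg_halfline _ _ (nbhs_filter b)).
case: b => [r|].
  apply: (@cvg_EFin R _ (nbhs r) _ (fun s : R => `|s|%:E)); first exact: nearW.
  by apply: cvg_norm; exact: cvg_id.
have FF : Filter (nbhs (None : P1 R)) := nbhs_filter _.
apply/(@cvgeyPge _ _ _ FF) => M.
exists [set` `[- M, M]].
  split; first exact: segment_compact.
  exact: interval_closed.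
move=> _ [[r nr <-]|->] /=; last by rewrite leey.
rewrite lee_fin leNgt; apply/negP => rM; apply: nr.
by rewrite /= in_itv/= -ler_norml ltW.
Qed.

Lemma halfline_compact : compact [set: halfline R].
Proof.
have -> : [set: halfline R] = halfline_of_P1 @` setT.
  apply/seteqP; split => // b _; exists (P1_of_halfline b) => //.
  apply: val_inj => /=; rewrite /P1_of_halfline.
  have := valP b; rewrite inE /=; case: (val b) => //= r.
  by rewrite lee_fin => r0; rewrite ger0_norm.
apply: continuous_compact; last exact: one_point_compactification_compact.
by apply: continuous_subspaceT; exact: halfline_of_P1_continuous.
Qed.

Lemma fmap_ultra (T U : Type) (f : T -> U) (F : set_system T) :
  UltraFilter F -> UltraFilter (f @ F).
Proof.
move=> FU; have FP := @ultra_proper _ _ FU.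
split; first exact: fmap_proper_filter.
move=> H HP FH; apply/seteqP; split => // A HA.
have [//|FA] := in_ultra_setVsetC (f @^-1` A) FU.
have HCA : H (~` A) by exact: FH.
by have [u [Au nAu]] := filter_ex (filterI HA HCA).
Qed.

Lemma FM_ambient_compact n : compact [set: FM_ambient R n].
Proof.
have tych (I : choiceType) (U : topologicalType) : compact [set: U] ->
    compact [set: {ptws I -> U}].
  move=> cU; have := @tychonoff I (fun _ => U) (fun _ => setT) (fun _ => cU).
  by congr compact; apply/seteqP; split.
rewrite -setXTT; apply: compact_setX.
  by apply: tych; exact: circle_compact.
by apply: tych; exact: halfline_compact.
Qed.

(** Configurations whose images approach x are refined to an ultrafilter. By compactness their
    images under [FM_emb] converge to some y, and continuity of [FM_AH] together with uniqueness of
    limits, tested on real functions, gives that y lies over x. *)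
Lemma FM_to_XAH_surj n (x : AH R n) : XAH R n x ->
  exists2 y, FM R n y & FM_AH y = x.
Proof.
move=> xX.
pose F : set_system ('I_n -> plane R) :=
  filter_from (nbhs x) (fun U => @CONF R n `&` (@AH_emb R n) @^-1` U).
have FF : ProperFilter F.
  apply: filter_from_proper.
    apply: filter_from_filter; first by exists setT; exact: filterT.
    move=> U V nU nV; exists (U `&` V); first exact: filterI.
    by move=> p [pC [Up Vp]].
  by move=> U nU; have [_ [[p pC <-] Up]] := xX U nU; exists p.
have [G [GU FG]] := ultraFilterLemma FF.
have [GP _] := GU.
have := @FM_ambient_compact n; rewrite compact_ultra.
move=> /(_ ((@FM_emb R n) @ G) (fmap_ultra _ GU) filterT)[y [_ yP]].
have GC : G (@CONF R n) by apply: FG; exists setT; [exact: filterT|move=> p []].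
exists y.
  move=> U nU; have GU' : G (@FM_emb R n @^-1` U) := yP U nU.
  have /filter_ex[p [pC Up]] : G (@CONF R n `&` @FM_emb R n @^-1` U).
    exact: filterI.
  by exists (FM_emb p); split => //; exists p.
apply: AH_separated => f fc.
have h1 : (f \o @FM_AH R n \o @FM_emb R n) @ G --> f (FM_AH y).
  apply: (@cvg_comp _ _ _ (@FM_emb R n) (f \o @FM_AH R n) _ _ _ yP).
  apply: (@continuous_comp _ _ _ (@FM_AH R n) f); last exact: fc.
  exact: FM_AH_continuous.
have h2 : (f \o @FM_AH R n \o @FM_emb R n) @ G --> f x.
  move=> U /fc nU; apply: FG; exists (f @^-1` U) => // p [pC Up] /=.
  by rewrite FM_AH_emb.
exact: (cvg_unique _ h1 h2).
Qed.

End Topology.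

(** * The tree of clusters *)

Section Combinatorics.
Import boot.fintype boot.finset.
Local Open Scope set_scope.
Variables (R : realType) (n : nat) (x : AH R n).
Local Notation C := (pair_cluster x).
Implicit Types (i j k l : 'I_n) (S T M N : {set 'I_n}).

Lemma mem_pair_clusterl i j : i \in C i j.
Proof. by rewrite inE set21 orbT. Qed.

Lemma mem_pair_clusterr i j : j \in C i j.
Proof. by rewrite inE set22 orbT. Qed.

Lemma pair_clusterid i : C i i = [set i].
Proof.
rewrite /pair_cluster setUid; apply/setUidPr/subsetP => k.
rewrite inE => /existsP[t /andP[/eqP tE _]].
by have := valP t; rewrite tE /= eqxx andbF.
Qed.

Lemma abs_ratio_ge0 (h : klein R) : (0 <= abs_ratio h)%E.
Proof. by rewrite /abs_ratio; case: (repr h).1 => [r|] //=;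
  rewrite lee_fin. Qed.

Lemma zero_ratioE (t : triple_idx n) : (abs_ratio (x.2 t) == 0%E) =
  ((val t).1.2 \notin C (val t).1.1 (val t).2).
Proof.
case: (and3P (valP t)) => /= ij ik jk.
rewrite !inE [_ == (val t).1.1]eq_sym (negbTE ij) (negbTE jk) !orbF negb_exists.
apply/eqP/forallP => [t0 t'|/(_ t)].
  apply/negP => /andP[/eqP tt']; suff -> : t' = t by rewrite t0 ltxx.
  by apply: val_inj; rewrite tt' -!surjective_pairing.
have -> : val t == ((val t).1.1, (val t).1.2, (val t).2).
  by rewrite -!surjective_pairing.
by rewrite /= -leNgt => t0; apply/eqP; rewrite eq_le t0 abs_ratio_ge0.
Qed.

(* Csub and Ctotal are the ultrametric properties of C i j, the ball of centre
   i and radius the order of magnitude of |p_i - p_j|. *)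
Hypothesis Csub : forall i j k l,
  k \in C i j -> l \in C i j -> C k l \subset C i j.
Hypothesis Ctotal : forall i j k, (k \in C i j) || (j \in C i k).

Lemma pair_clusterC i j : C i j = C j i.
Proof.
by apply/eqP; rewrite eqEsubset !Csub ?mem_pair_clusterl ?mem_pair_clusterr.
Qed.

Lemma clustersP S : reflect (exists i j, S = C i j) (S \in clusters x).
Proof.
apply: (iffP setUP) => [[/imsetP[e _ ->]|/imsetP[i _ ->]]|[i [j ->]]].
- by exists (val e).1, (val e).2.
- by exists i, i; rewrite pair_clusterid.
case: (ltngtP i j) => [ij|ji|/val_inj ->].
- by left; apply/imsetP; exists (exist _ (i, j) ij).
- by left; apply/imsetP; exists (exist _ (j, i) ji); rewrite // pair_clusterC.
- by right; apply/imsetP; exists j; rewrite // pair_clusterid.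
Qed.

Lemma pair_cluster_sub S k l :
  S \in clusters x -> k \in S -> l \in S -> C k l \subset S.
Proof. by move=> /clustersP[i [j ->]]; exact: Csub. Qed.

(** Every point of an ultrametric ball is a centre of it. *)
Lemma cluster_center S k : S \in clusters x -> k \in S ->
  exists2 l, l \in S & S = C k l.
Proof.
move=> /clustersP[i [j ->]] kS.
have [iS jS] := (mem_pair_clusterl i j, mem_pair_clusterr i j).
have /orP[jk|ik] := Ctotal k i j; [exists i => //|exists j => //];
  apply/eqP; rewrite eqEsubset !Csub ?mem_pair_clusterl ?mem_pair_clusterr//.
Qed.

(** Both clusters are balls about the common point k, and [Ctotal] compares their radii. *)
Lemma clusters_laminar S T k : S \in clusters x -> T \in clusters x ->
  k \in S -> k \in T -> (S \subset T) || (T \subset S).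
Proof.
move=> Sx Tx kS kT.
have [a aS ->] := cluster_center Sx kS; have [b bT ->] := cluster_center Tx kT.
by have /orP[h|h] := Ctotal k a b; apply/orP; [right|left]; apply: Csub;
  rewrite ?mem_pair_clusterl ?mem_pair_clusterr.
Qed.

Lemma setT_cluster : (0 < n)%N -> [set: 'I_n] \in clusters x.
Proof.
move=> n0; pose i0 := Ordinal n0; apply/clustersP.
(* A ball about [i0] of largest cardinality is everything: if m lies in C i0 k, then C i0 m is
   contained in C i0 k, and maximality makes them equal. *)
pose m := [arg max_(j > i0) #|C i0 j|]; exists i0, m; apply/esym/setP => k.
rewrite [RHS]inE; have /orP[//|h] := Ctotal i0 m k.
suff -> : C i0 m = C i0 k by exact: mem_pair_clusterr.
apply/eqP; rewrite eqEcard Csub ?mem_pair_clusterl//= /m.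
by case: arg_maxnP => // j _ jmax; exact: jmax.
Qed.

(** * Maximal subclusters and their minimal labels *)

Lemma maximal_subcluster_disjoint M N S k :
  maximal_subcluster x M S -> maximal_subcluster x N S ->
  k \in M -> k \in N -> M = N.
Proof.
move=> /and4P[Mx Sx MS /forall_inP Mmax] /and4P[Nx _ NS /forall_inP Nmax] kM kN.
apply/eqP; have /orP[h|h] := clusters_laminar Mx Nx kM kN; apply/contraT.
  by have := Mmax _ Nx; rewrite NS andbT properEneq h andbT => /negPn ->.
by have := Nmax _ Mx; rewrite MS andbT properEneq h andbT eq_sym => /negPn ->.
Qed.

Lemma maximal_subcluster_above N S : N \in clusters x -> S \in clusters x ->
  N \proper S -> exists2 M, maximal_subcluster x M S & N \subset M.
Proof.
move=> Nx Sx NS.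
pose P M := [&& M \in clusters x, M \proper S & N \subset M].
have PN : P N by rewrite /P Nx NS subxx.
case: (@arg_maxnP _ N P (fun M => #|M|) PN) => M /and3P[Mx MS NM] Mmax.
exists M => //; apply/and4P; split=> //; apply/forall_inP => L Lx.
apply/negP => /andP[ML LS]; have : (#|L| <= #|M|)%N.
  by apply: Mmax; rewrite /P Lx LS (subset_trans NM (proper_sub ML)).
by rewrite leqNgt proper_card.
Qed.

Lemma parent_cluster S T : S \in clusters x -> T \in clusters x ->
  S \proper T -> exists P, maximal_subcluster x S P.
Proof.
move=> Sx Tx ST.
pose P M := (M \in clusters x) && (S \proper M).
have PT : P T by rewrite /P Tx ST.
case: (@arg_minnP _ T P (fun M => #|M|) PT) => M /andP[Mx SM] Mmin.
exists M; apply/and4P; split=> //; apply/forall_inP => L Lx.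
apply/negP => /andP[SL LM]; have : (#|M| <= #|L|)%N by apply: Mmin;
  rewrite /P Lx SL.
by rewrite leqNgt proper_card.
Qed.

Lemma parent_cluster_uniq S T T' k : k \in S -> maximal_subcluster x S T ->
  maximal_subcluster x S T' -> T = T'.
Proof.
move=> kS /and4P[Sx Tx ST /forall_inP h] /and4P[_ Tx' ST' /forall_inP h'].
apply/eqP/contraT => TT'.
have kT := subsetP (proper_sub ST) _ kS.
have kT' := subsetP (proper_sub ST') _ kS.
have /orP[sT|sT] := clusters_laminar Tx Tx' kT kT'.
  by have := h' _ Tx; rewrite ST properEneq TT' sT.
by have := h _ Tx'; rewrite ST' properEneq eq_sym TT' sT.
Qed.

Lemma mem_min_labels S j : j \in min_labels x S ->
  exists M, [/\ maximal_subcluster x M S, j \in M & forall k, k \in M -> (j <=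
    k)%N].
Proof.
rewrite mem_filter => /andP[/existsP[M /and3P[MS jM /forall_inP jmin]] _].
by exists M.
Qed.

Lemma min_labels_sub S j : j \in min_labels x S -> j \in S.
Proof.
move=> /mem_min_labels[M [/and4P[_ _ MS _] jM _]].
exact: (subsetP (proper_sub MS)).
Qed.

Lemma min_label_of M S k : maximal_subcluster x M S -> k \in M ->
  exists2 j, j \in min_labels x S & (j \in M) && (j <= k)%N.
Proof.
move=> MS kM; case: (@arg_minnP _ k (mem M) (fun i => val i) kM) => j jM jmin.
exists j; last by apply/andP; split; [exact: jM|exact: jmin].
rewrite mem_filter mem_enum andbT; apply/existsP; exists M.
by apply/and3P; split=> //; apply/forall_inP => i iM; exact: jmin.
Qed.

Lemma min_labels_uniq S : uniq (min_labels x S).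
Proof. by rewrite filter_uniq// enum_uniq. Qed.

Lemma min_labels_sorted S :
  sorted (fun i j : 'I_n => i < j)%N (min_labels x S).
Proof.
apply: sorted_filter; first by move=> ? ? ?; exact: ltn_trans.
by have := iota_ltn_sorted 0 n; rewrite -val_enum_ord sorted_map.
Qed.

Lemma sub_maximal_cluster S k : S \in clusters x -> k \in S -> (1 < #|S|)%N ->
  exists2 M, maximal_subcluster x M S & k \in M.
Proof.
move=> Sx kS S1.
have kx : [set k] \in clusters x by apply/clustersP; exists k, k;
  rewrite pair_clusterid.
have kpS : [set k] \proper S by rewrite properEcard sub1set kS cards1.
have [M MS kM] := maximal_subcluster_above kx Sx kpS.
by exists M; rewrite // -sub1set.
Qed.

(** If C a b were smaller than S, it would lie in a single maximal subcluster; a and b would both be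
    its minimum. *)
Lemma pair_cluster_labels S a b : S \in clusters x ->
  a \in min_labels x S -> b \in min_labels x S -> a != b -> C a b = S.
Proof.
move=> Sx aS bS; have sub :=
  pair_cluster_sub Sx (min_labels_sub aS) (min_labels_sub bS).
apply: contraNeq => CS.
have Cx : C a b \in clusters x by apply/clustersP; exists a, b.
have CpS : C a b \proper S by rewrite properEneq CS.
have [M MS CM] := maximal_subcluster_above Cx Sx CpS.
have [N [NS aN Na]] := mem_min_labels aS; have [L [LS bL Lb]] :=
  mem_min_labels bS.
have aM := subsetP CM _ (mem_pair_clusterl a b).
have bM := subsetP CM _ (mem_pair_clusterr a b).
have NM := maximal_subcluster_disjoint NS MS aN aM.
have LM := maximal_subcluster_disjoint LS MS bL bM.
by apply/eqP/val_inj/anti_leq; rewrite Na ?NM// Lb ?LM.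
Qed.

(** Write S = C i j. A maximal subcluster containing both i and j would contain C i j = S, so i and
    j lie in different ones, and these contribute two distinct labels. *)
Lemma min_labelsE S : S \in clusters x -> (1 < #|S|)%N ->
  exists a b s, min_labels x S = [:: a, b & s].
Proof.
move=> Sx S1.
have /clustersP[i [j SE]] := Sx.
have iS : i \in S by rewrite SE mem_pair_clusterl.
have jS : j \in S by rewrite SE mem_pair_clusterr.
have [M MS iM] := sub_maximal_cluster Sx iS S1.
have [N NS jN] := sub_maximal_cluster Sx jS S1.
have [a aS /andP[aM _]] := min_label_of MS iM.
have [b bS /andP[bN _]] := min_label_of NS jN.
have ab : a != b.
  apply/eqP => ab; rewrite -ab in bN.
  have MN := maximal_subcluster_disjoint MS NS aM bN.
  have /and4P[Mx _ MpS _] := MS.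
  have := pair_cluster_sub Mx iM (_ : j \in M); rewrite MN => /(_ jN).
  by rewrite -SE -MN => /(proper_sub_trans MpS); rewrite properxx.
have : (size [:: a; b] <= size (min_labels x S))%N.
  apply: uniq_leq_size; first by rewrite /= inE ab.
  by move=> c; rewrite !inE => /orP[/eqP->|/eqP->].
by case: (min_labels x S) => [|a' [|b' s]] // _; exists a', b', s.
Qed.

Lemma head_min_labels S a s k : S \in clusters x -> (1 < #|S|)%N ->
  min_labels x S = a :: s -> k \in S -> (a <= k)%N.
Proof.
move=> Sx S1 SE kS.
have [M MS kM] := sub_maximal_cluster Sx kS S1.
have [b] := min_label_of MS kM; rewrite SE => + /andP[_ bk].
have := min_labels_sorted S; rewrite SE /= => aP.
rewrite inE => /orP[/eqP <-//|bs]; apply: leq_trans bk; apply: ltnW.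
have tr : transitive (fun i j : 'I_n => i < j)%N by move=> ? ? ?; exact:
  ltn_trans.
by move: aP; rewrite (path_sortedE tr) => /andP[/allP/(_ _ bs)].
Qed.

(** * Counting the selected hooks of ratio zero *)

Definition big_clusters : {set {set 'I_n}} :=
  [set S in clusters x | 1 < #|S|]%N.

(** For the hook h^{ik}_{ij} this is the cluster spanned by i and k. On the hooks of rule (b) it
    recovers the selecting cluster. *)
Definition spanned_cluster (t : triple_idx n) : {set 'I_n} :=
  C (val t).1.1 (val t).2.

Lemma outer_hook_spanned S t : S \in big_clusters ->
  selects_outer_hook x S t -> spanned_cluster t = S /\ S != setT.
Proof.
rewrite inE => /andP[Sx S1]; have [a [b [s SE]]] := min_labelsE Sx S1.
rewrite /selects_outer_hook /spanned_cluster.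
case tE : (val t) => [[j1 i] j2] /and4P[ST].
rewrite /min_label SE /= => /eqP[<-] /eqP[<-] _; split=> //.
have ab : a != b.
  by have := min_labels_uniq S; rewrite SE /= inE negb_or => /andP[/andP[]].
by apply: pair_cluster_labels; rewrite // SE !inE eqxx ?orbT.
Qed.

(** The parent of S is unique and labels are determined by their position, so rule (b) leaves no
    choice. *)
Lemma outer_hook_uniq S t t' : S \in big_clusters ->
  selects_outer_hook x S t -> selects_outer_hook x S t' -> t = t'.
Proof.
rewrite inE => /andP[Sx S1]; have [a [b [s SE]]] := min_labelsE Sx S1.
rewrite /selects_outer_hook.
case tE : (val t) => [[j1 i] j2]; case tE' : (val t') => [[j1' i'] j2'].
rewrite /min_label SE /=.
move=> /and4P[_ /eqP[ka] /eqP[kb] /existsP[T /andP[ST /existsP[i1 /andP[Ti1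
  iP]]]]].
move=> /and4P[_ /eqP[ja] /eqP[jb] /existsP[T' /andP[ST' /existsP[i1'
  /andP[Ti1' iP']]]]].
have aS : a \in S by apply: min_labels_sub; rewrite SE inE eqxx.
have TT' := parent_cluster_uniq aS ST ST'; rewrite -TT' in Ti1' iP'.
have ii : i1 = i1' by move: Ti1 Ti1' => /eqP -> /eqP[].
apply: val_inj; rewrite tE tE' -ja -jb -ka -kb; congr (_, _, _).
move: iP iP'; rewrite -ii -ja -ka; case: ifP => _;
  first by move=> /eqP -> /eqP ->.
by move=> /andP[_ /eqP iE] /andP[_]; rewrite iE => /eqP[].
Qed.

(** The labels j1 and jr span all of S, which contains j2. *)
Lemma inner_hook_nonzero S t : S \in big_clusters ->
  selects_inner_hook x S t -> abs_ratio (x.2 t) != 0%E.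
Proof.
rewrite inE => /andP[Sx S1]; rewrite zero_ratioE negbK /selects_inner_hook.
have := valP t; case: (val t) => [[j1 j2] j3] /= /and3P[_ j13 _].
have lab r j : min_label x S r j -> j \in min_labels x S.
  by rewrite /min_label => /eqP h; apply/onthP; exists r.-1.
move=> /and3P[/lab l1 /lab l2 /existsP[r /andP[_ /lab l3]]].
by rewrite (pair_cluster_labels Sx l1 l3 j13) min_labels_sub.
Qed.

Lemma outer_hook_exists S : (0 < n)%N -> S \in big_clusters -> S != setT ->
  exists2 t, selects_outer_hook x S t & abs_ratio (x.2 t) = 0%E.
Proof.
move=> n0; rewrite inE => /andP[Sx S1] SnT.
have [a [b [s SE]]] := min_labelsE Sx S1.
have aL : a \in min_labels x S by rewrite SE inE eqxx.
have bL : b \in min_labels x S by rewrite SE !inE eqxx orbT.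
have ab : a != b.
  by have := min_labels_uniq S; rewrite SE /= inE negb_or => /andP[/andP[]].
have aS := min_labels_sub aL.
have CS := pair_cluster_labels Sx aL bL ab.
have amin k : k \in S -> (a <= k)%N := head_min_labels Sx S1 SE.
have [|T ST] := parent_cluster Sx (setT_cluster n0).
  by rewrite properEneq SnT subsetT.
have /and4P[_ Tx SpT _] := ST.
have T1 : (1 < #|T|)%N := ltn_trans S1 (proper_card SpT).
have [i1 [i2 [r TE]]] := min_labelsE Tx T1.
have i1a : (i1 <= a)%N.
  by apply: (head_min_labels Tx T1 TE); exact: (subsetP (proper_sub SpT)).
(* Since a and b span S, the ratio vanishes as soon as the label i taken from the parent lies
   outside S. If i1 < a, then i1 is below the minimum of S; otherwise S is the maximal subcluster
   with label i1, and i2 belongs to another one. *)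
suff [i iS iP] : exists2 i, i \notin S &
    if (i1 < a)%N then i == i1 else (a == i1) && (i == i2).
  have ai : a != i by apply: contraNneq iS => <-.
  have ib : i != b by apply: contraNneq iS => ->; exact: min_labels_sub.
  have tP : [&& a != i, a != b & i != b] by rewrite ai ab ib.
  exists (exist _ (a, i, b) tP); last first.
    by apply/eqP; rewrite zero_ratioE /= CS.
  rewrite /selects_outer_hook /= SnT /min_label SE !eqxx /=.
  apply/existsP; exists T; rewrite ST; apply/existsP; exists i1.
  by rewrite TE eqxx /= (inj_eq (@Some_inj _)) [i2 == i]eq_sym.
have [lt|ge] := ltnP i1 a.
  by exists i1 => //; apply: contraL lt => /amin; rewrite -leqNgt.
have i1E : a = i1 by apply/val_inj/anti_leq; rewrite ge.
exists i2; last by rewrite i1E !eqxx.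
apply/negP => i2S.
have i2L : i2 \in min_labels x T by rewrite TE !inE eqxx orbT.
have [M [MT i2M i2min]] := mem_min_labels i2L.
have MS : M = S by apply: maximal_subcluster_disjoint MT ST i2M i2S.
have : i1 != i2.
  by have := min_labels_uniq T; rewrite TE /= inE negb_or => /andP[/andP[]].
rewrite -i1E => /negP; apply; apply/eqP/val_inj/anti_leq.
by rewrite amin//= i2min// MS.
Qed.

(** [spanned_cluster] is a bijection from the selected hooks of ratio 0 to the big clusters other
    than [n]; the successor accounts for [n]. *)
Lemma card_zero_ratios : (1 < n)%N -> #|zero_ratios x|.+1 = #|big_clusters|.
Proof.
move=> n1; have n0 := ltnW n1.
have TK : setT \in big_clusters by rewrite inE setT_cluster//= cardsT card_ord.
have zeroP t : t \in zero_ratios x ->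
    exists2 S, S \in big_clusters & selects_outer_hook x S t.
  rewrite !inE => /andP[/exists_inP[S Sx /andP[S2 /orP[h|h]]]].
    by exists S; rewrite // inE Sx.
  have SK : S \in big_clusters by rewrite inE Sx.
  by rewrite (negbTE (inner_hook_nonzero SK h)).
rewrite (cardsD1 setT big_clusters) TK add1n; congr _.+1.
rewrite -(@card_in_imset _ _ spanned_cluster).
  apply: eq_card => S; apply/imsetP/setD1P => [[t /zeroP[S' S'K h] ->]|[ST SK]].
    by have [-> ?] := outer_hook_spanned S'K h.
  have [t h t0] := outer_hook_exists n0 SK ST.
  exists t; last by have [] := outer_hook_spanned SK h.
  rewrite !inE t0 eqxx andbT; apply/exists_inP; exists S.
    by move: SK; rewrite inE => /andP[].
  by rewrite h /= andbT; move: SK; rewrite inE => /andP[].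
move=> t t' /zeroP[S SK h] /zeroP[S' SK' h'] E.
have [E1 _] := outer_hook_spanned SK h; have [E2 _] :=
  outer_hook_spanned SK' h'.
by rewrite -E2 -E E1 in h'; exact: outer_hook_uniq SK h h'.
Qed.

End Combinatorics.

(** * Asymptotics of distances *)

Lemma ereal_gt0_exists (R : realType) (L : \bar R) : (0 < L)%E ->
  exists2 c : R, 0 < c & (c%:E < L)%E.
Proof.
case: L => [r|_|//]; last by exists 1 => //; exact: ltry.
by rewrite lte_fin => r0; exists (r / 2); rewrite ?lte_fin; lra.
Qed.

Section Asymptotics.
Variables (R : realType) (n : nat) (y : FM_ambient R n).
Local Notation C := (pair_cluster (FM_AH y)).
Implicit Types (i j k l m : 'I_n) (p : 'I_n -> plane R).

(** The configurations sent into the neighbourhoods of y generate such a filter, proper because y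
    lies in the closure. Asymptotic statements about y are made along it. *)
Lemma FM_filter : FM R n y -> exists F : set_system ('I_n -> plane R),
  [/\ ProperFilter F, F (@CONF R n) & @FM_emb R n @ F --> y].
Proof.
move=> yF.
exists (filter_from (nbhs y) (fun U => @CONF R n `&` @FM_emb R n @^-1` U)).
split.
- apply: filter_from_proper.
    apply: filter_from_filter; first by exists setT; exact: filterT.
    move=> U V nU nV; exists (U `&` V); first exact: filterI.
    by move=> p [pC [Up Vp]].
  by move=> U nU; have [_ [[p pC <-] Up]] := yF U nU; exists p.
- by exists setT; [exact: filterT|move=> p []].
- by move=> U nU; exists U => // p [].
Qed.

Lemma abs_ratio_FM t : abs_ratio ((FM_AH y).2 t) = val (y.2 t).
Proof.
rewrite /FM_AH /= abs_ratio_class /FM_hook; case: (val t) => [[i j] k] /=.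
rewrite /P1_of_halfline; have := valP (y.2 t); rewrite inE /=.
by case: (val (y.2 t)) => //= r; rewrite lee_fin => r0; rewrite ger0_norm.
Qed.

Definition dist p i j : R := enorm (p i - p j).

Lemma dist_ge0 p i j : 0 <= dist p i j.
Proof. exact: sqrtr_ge0. Qed.

Lemma distC p i j : dist p i j = dist p j i.
Proof. by rewrite /dist -opprB enormN. Qed.

Lemma dist_trig p i j k : dist p i k <= dist p i j + dist p j k.
Proof. by apply: le_trans (ler_enormD _ _); rewrite addrA subrK. Qed.

Lemma distxx p i : dist p i i = 0.
Proof. by rewrite /dist subrr /enorm /= expr0n addr0 sqrtr0. Qed.

Lemma dist_gt0 p i j : CONF p -> i != j -> 0 < dist p i j.
Proof.
move=> pC ij; apply: enorm_gt0; rewrite subr_eq0.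
by apply: contra ij => /eqP/pC->.
Qed.

Variable F : set_system ('I_n -> plane R).
Context {FF : ProperFilter F}.
Hypothesis FC : F (@CONF R n).
Hypothesis Fy : @FM_emb R n @ F --> y.

Lemma CONF_near_ex (P Q : set ('I_n -> plane R)) : F P -> F Q ->
  exists p, [/\ CONF p, P p & Q p].
Proof.
move=> FP FQ; have /filter_ex[p [pC [Pp Qp]]] : F (@CONF R n `&` (P `&` Q)).
  by do 2![apply: filterI => //].
by exists p.
Qed.

Lemma beta_cvg (t : triple_idx n) :
  (fun p => (beta p (val t).1.1 (val t).1.2 (val t).2)%:E) @ F --> val (y.2 t).
Proof.
apply: (@cvg_comp _ _ _ (@FM_emb R n) (fun z : FM_ambient R n =>
  val (z.2 t)) _ _ _ Fy).
apply: (@continuous_comp _ _ _ (fun z : FM_ambient R n => z.2 t) val).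
  apply: (@continuous_comp _ _ _ snd (fun a : {ptws _ -> _} => a t)).
    exact: cvg_snd.
  exact: (@proj_continuous _ (fun _ => halfline R)).
exact: (@initial_continuous (halfline R) (\bar R) val).
Qed.

Lemma alpha_cvg (e : pair_idx n) :
  (fun p => alpha p (val e).1 (val e).2) @ F --> y.1 e.
Proof.
apply: (@cvg_comp _ _ _ (@FM_emb R n) (fun z : FM_ambient R n =>
  z.1 e) _ _ _ Fy).
apply: (@continuous_comp _ _ _ fst (fun a : {ptws _ -> _} => a e)).
  exact: cvg_fst.
exact: (@proj_continuous _ (fun _ => circle R)).
Qed.

Lemma beta_near_gt t (c : R) : (c%:E < val (y.2 t))%E ->
  F (fun p => c < beta p (val t).1.1 (val t).1.2 (val t).2).
Proof. by move=> /open_ereal_gt' /(beta_cvg (t := t)). Qed.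

Lemma beta_near_lt t (c : R) : (val (y.2 t) < c%:E)%E ->
  F (fun p => beta p (val t).1.1 (val t).1.2 (val t).2 < c).
Proof. by move=> /open_ereal_lt' /(beta_cvg (t := t)). Qed.

Lemma mem_pair_cluster_triple (t : triple_idx n) :
  ((val t).1.2 \in C (val t).1.1 (val t).2) = (0 < val (y.2 t))%E.
Proof.
rewrite -[LHS]negbK -zero_ratioE abs_ratio_FM lt0e.
by have := valP (y.2 t); rewrite inE /= => ->; rewrite andbT.
Qed.

(** This is |p_i - p_k| = O(|p_i - p_j|) along F. The ratio |p_i - p_j| / |p_i - p_k| has a limit in
    [0, oo]: a positive limit bounds the inverse ratio, a zero limit excludes every bound. *)
Lemma pair_cluster_near i j k : k \in C i j <->
  exists2 M : R, 0 <= M & F (fun p => dist p i k <= M * dist p i j).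
Proof.
have [->|ik] := eqVneq k i.
  split=> _; last exact: mem_pair_clusterl.
  by exists 0 => //; apply: nearW => p; rewrite distxx mul0r.
have [->|jk] := eqVneq k j.
  split=> _; last exact: mem_pair_clusterr.
  by exists 1 => //; apply: nearW => p; rewrite mul1r.
have [<-{jk j}|ij] := eqVneq i j.
  rewrite pair_clusterid inE (negbTE ik); split=> // -[M _ MF].
  have [p [pC _]] := CONF_near_ex FC MF.
  by rewrite distxx mulr0 leNgt dist_gt0// eq_sym.
have tP : [&& i != k, i != j & k != j] by rewrite eq_sym ik ij jk.
pose t : triple_idx n := exist _ (i, k, j) tP.
rewrite (mem_pair_cluster_triple t : (k \in C i j) = _); split =>
  [L0|[M M0 MF]].
  have [c c0 cL] := ereal_gt0_exists L0.
  exists c^-1; first by rewrite invr_ge0 ltW.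
  have cb : F (fun p => c < beta p i k j) := beta_near_gt cL.
  apply: filterS2 FC cb => p pC.
  rewrite /beta -/(dist p i j) -/(dist p i k) ltr_pdivlMr; last first.
    by rewrite dist_gt0// eq_sym.
  by move=> /ltW; rewrite mulrC -ler_pdivlMr// mulrC.
rewrite lt0e (_ : (0 <= val (y.2 t))%E) ?andbT; last first.
  by have := valP (y.2 t); rewrite inE.
apply/eqP => L0.
(* [M + 1] is inverted because [M] may be 0. *)
have M1 : 0 < (M + 1)^-1 by rewrite invr_gt0; lra.
have sm : F (fun p => beta p i k j < (M + 1)^-1).
  by apply: (@beta_near_lt t); rewrite L0 lte_fin.
have [p [pC bp dp]] := CONF_near_ex sm MF.
move: bp; rewrite /beta -/(dist p i j) -/(dist p i k).
have d0 : 0 < dist p i k by rewrite dist_gt0// eq_sym.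
have d1 : 0 < dist p i j by rewrite dist_gt0.
rewrite ltr_pdivrMr// -ltr_pdivrMl ?invr_gt0 ?invrK//; last lra.
by rewrite ltNge (le_trans dp)// ler_wpM2r ?(ltW d1)//; lra.
Qed.

(** Outside the cluster the ratio tends to 0, so |p_i - p_j| = o(|p_i - p_k|). *)
Lemma pair_clusterN_near i j k : k \notin C i j ->
  forall e : R, 0 < e -> F (fun p => dist p i j <= e * dist p i k).
Proof.
move=> kC e e0.
have [ki|ik] := eqVneq k i; first by rewrite ki mem_pair_clusterl in kC.
have [kj|jk] := eqVneq k j; first by rewrite kj mem_pair_clusterr in kC.
have [->|ij] := eqVneq i j.
  by apply: nearW => p; rewrite distxx mulr_ge0 ?dist_ge0 ?(ltW e0).
have tP : [&& i != k, i != j & k != j] by rewrite eq_sym ik ij jk.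
pose t : triple_idx n := exist _ (i, k, j) tP.
have Fe : F (fun p => beta p i k j < e).
  apply: (@beta_near_lt t); move: kC;
    rewrite (mem_pair_cluster_triple t) -leNgt.
  by move=> /le_lt_trans; apply; rewrite lte_fin.
apply: filterS2 FC Fe => p pC.
rewrite /beta -/(dist p i j) -/(dist p i k) ltr_pdivrMr; first exact: ltW.
by rewrite dist_gt0// eq_sym.
Qed.

Lemma pair_cluster_total i j k : (k \in C i j) || (j \in C i k).
Proof.
apply/orP; have [|kC] := boolP (k \in C i j); [by left|right].
by apply/pair_cluster_near; exists 1 => //; exact: pair_clusterN_near.
Qed.

Lemma pair_cluster_closed i j k l :
  k \in C i j -> l \in C i j -> C k l \subset C i j.
Proof.
move=> /pair_cluster_near[K K0 Kik] /pair_cluster_near[L L0 Lil].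
apply/fintype.subsetP => m /pair_cluster_near[M M0 Mkm].
(* Two triangle inequalities: |p_i - p_m| <= |p_i - p_k| + M |p_k - p_l|, and |p_k - p_l| <= (K + L)
   |p_i - p_j|. *)
apply/pair_cluster_near; exists (K + M * (K + L)).
  by rewrite addr_ge0 ?mulr_ge0 ?addr_ge0.
apply: filterS3 Kik Lil Mkm => p Kik Lil Mkm.
rewrite (le_trans (dist_trig p i k m))// mulrDl lerD//.
rewrite (le_trans Mkm)// -mulrA ler_wpM2l//.
by rewrite (le_trans (dist_trig p k i l))// mulrDl lerD// distC.
Qed.

(** With [mem_pair_cluster_triple] this reads off from the clusters whether a ratio is 0, infinite,
    or in (0, oo). *)
Lemma ratio_lt_pinfty (t : triple_idx n) :
  (val (y.2 t) < +oo)%E = ((val t).2 \in C (val t).1.1 (val t).1.2).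
Proof.
case: (and3P (valP t)) => ij ik jk.
apply/idP/idP => [Loo|/pair_cluster_near[M M0 MF]].
  apply/pair_cluster_near; exists (fine (val (y.2 t)) + 1).
    by rewrite addr_ge0// fine_ge0//; have := valP (y.2 t); rewrite inE.
  have Fb : F (fun p => beta p (val t).1.1 (val t).1.2 (val t).2 < fine (val
    (y.2 t)) + 1).
    apply: beta_near_lt; have := valP (y.2 t); rewrite inE => L0.
    have Lfin : val (y.2 t) \is a fin_num by rewrite ge0_fin_numE.
    by rewrite -{1}(fineK Lfin) lte_fin ltrDl.
  apply: filterS2 FC Fb => p pC.
  by rewrite /beta ltr_pdivrMr ?dist_gt0// => /ltW.
rewrite ltNge leye_eq; apply/eqP => Loo.
have Fb : F (fun p => M < beta p (val t).1.1 (val t).1.2 (val t).2).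
  by apply: beta_near_gt; rewrite Loo ltry.
have [p [pC bp dp]] := CONF_near_ex Fb MF.
by move: bp; rewrite /beta ltr_pdivlMr ?dist_gt0// ltNge dp.
Qed.

End Asymptotics.

(** * Flipping a cluster *)

Section Flip.
Variables (R : realType) (n : nat).
Implicit Types (i j k l m : 'I_n) (p : 'I_n -> plane R) (S : {set 'I_n}).
Implicit Types (y : FM_ambient R n).

Lemma near_eq_cvg_to (T : Type) (U : topologicalType) (F : set_system T)
    {FF : Filter F} (f g : T -> U) (l : U) :
  f @ F --> l -> F (fun t => f t = g t) -> g @ F --> l.
Proof.
move=> fl fg V nV; have FV : F (f @^-1` V) := fl V nV.
suff : F (g @^-1` V) by [].
by apply: filterS2 fg FV => t /= <-.
Qed.

Lemma ptws_cvg (T I : Type) (U : topologicalType) (F : set_system T)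
    {FF : Filter F} (g : T -> {ptws I -> U}) (a : {ptws I -> U}) :
  (forall i : I, (fun t => g t i) @ F --> a i) -> g @ F --> a.
Proof.
move=> gc; apply/cvg_sup => i V [_ [[W oW <-] Wx WV]].
apply: (filterS WV); apply: (gc i W).
exact: open_nbhs_nbhs.
Qed.

Lemma FM_cluster_closed y : FM R n y -> forall i j k l,
  k \in pair_cluster (FM_AH y) i j -> l \in pair_cluster (FM_AH y) i j ->
  pair_cluster (FM_AH y) k l \subset pair_cluster (FM_AH y) i j.
Proof.
by move=> /FM_filter[F [FF FC Fy]] i j k l; exact: (pair_cluster_closed FC Fy).
Qed.

Lemma FM_cluster_total y : FM R n y -> forall i j k,
  (k \in pair_cluster (FM_AH y) i j) || (j \in pair_cluster (FM_AH y) i k).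
Proof.
by move=> /FM_filter[F [FF FC Fy]] i j k; exact: (pair_cluster_total FC Fy).
Qed.

Definition flip_angles S y : FM_ambient R n :=
  (fun e => if ((val e).1 \in S) && ((val e).2 \in S) then y.1 e + cpi R
            else y.1 e,
   y.2).

Lemma FM_angle_flip S y i j : i != j -> FM_angle (flip_angles S y) i j =
  if (i \in S) && (j \in S) then FM_angle y i j + cpi R else FM_angle y i j.
Proof.
move=> ij; rewrite /FM_angle; case: insubP => [e _ eE|] /=; first by rewrite eE.
move=> nij; case: insubP => [e _ eE|] /=; last first.
  by move: ij nij; rewrite -val_eqE /=; case: ltngtP.
by rewrite eE /= andbC; case: ifP.
Qed.

Lemma FM_hookE y (t : triple_idx n) : FM_hook y t =
  (P1_of_halfline (y.2 t), FM_angle y (val t).1.1 (val t).2 -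
                           FM_angle y (val t).1.1 (val t).1.2).
Proof. by rewrite /FM_hook; case: (val t) => [[]]. Qed.

Lemma FM_angleC y i j : i != j -> FM_angle y j i = FM_angle y i j + cpi R.
Proof.
rewrite /FM_angle => ij.
case: insubP => [e eP eE|nji].
  case: insubP => [e' e'P e'E|_]; first by have := ltn_trans eP e'P;
    rewrite ltnn.
  by rewrite -addrA cpiD addr0.
case: insubP => [e _ _ //|nij].
by move: ij nji nij; rewrite -val_eqE /=; case: ltngtP.
Qed.

(** The half turn about p_r applied to the points labelled by S: it negates differences within S and
    moves p_i by 2 (p_r - p_i). *)
Definition reflect_at (r : 'I_n) S p : 'I_n -> plane R :=
  fun i => if i \in S then p r + p r - p i else p i.

Section Limit.
Variables (y : FM_ambient R n) (S : {set 'I_n}) (r : 'I_n).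
Hypothesis rS : r \in S.
Variable F : set_system ('I_n -> plane R).
Context {FF : ProperFilter F}.
Hypothesis FC : F (@CONF R n).
Hypothesis Fy : @FM_emb R n @ F --> y.
Hypothesis Sy : S \in clusters (FM_AH y).
Local Notation q p := (reflect_at r S p).

(** The leading part of q_j - q_i, where q is the reflected configuration. *)
Let signed p i j : plane R :=
  if (i \in S) && (j \in S) then - (p j - p i) else p j - p i.

(** The error is 0 when both or neither of i, j lie in S. If only a lies in S and b is the other
    label, its norm is 2 |p_a - p_r|, which is o(|p_a - p_b|) because b is outside the cluster
    spanned by a and r. *)
Lemma reflect_at_near i j (e : R) : 0 < e ->
  F (fun p => enorm (q p j - q p i - signed p i j) <= e * dist p i j).
Proof.
move=> e0.
have small a b : a \in S -> b \notin S ->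
    F (fun p => dist p a r + dist p a r <= e * dist p a b).
  move=> aS bS; have bC : b \notin pair_cluster (FM_AH y) a r.
    apply: contra bS; apply: fintype.subsetP.
    by apply: pair_cluster_sub Sy aS rS; exact: (pair_cluster_closed FC Fy).
  have e20 : 0 < e / 2 by lra.
  apply: filterS (pair_clusterN_near FC Fy bC e20) => p; lra.
have z0 : enorm (0 : plane R) = 0 by rewrite /enorm /= expr0n addr0 sqrtr0.
have ring1 (a b c : plane R) : a - (b + b - c) - (a - c) = (c - b) + (c - b).
  by congr pair => /=; ring.
have ring2 (a b c : plane R) : b + b - a - c - (a - c) = - ((a - b) + (a - b)).
  by congr pair => /=; ring.
rewrite /reflect_at /signed.
have [iS|iS] := boolP (i \in S); have [jS|jS] := boolP (j \in S) => /=.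
- apply: nearW => p; rewrite (_ :
  _ - _ - _ = 0) ?z0 ?mulr_ge0 ?dist_ge0 ?(ltW e0)//.
  by congr pair => /=; ring.
- apply: filterS (small _ _ iS jS) => p; rewrite ring1 => /(le_trans _); apply.
  exact: ler_enormD.
- apply: filterS (small _ _ jS iS) => p;
  rewrite ring2 enormN [dist p i j]distC => /(le_trans _); apply.
  exact: ler_enormD.
- by apply: nearW => p; rewrite subrr z0 mulr_ge0 ?dist_ge0 ?(ltW e0).
Qed.

Lemma enorm_signed p i j : enorm (signed p i j) = dist p i j.
Proof. by rewrite /signed; case: ifP => _; rewrite ?enormN -distC. Qed.

Lemma signed_neq0 p i j : CONF p -> i != j -> signed p i j != 0.
Proof.
move=> pC ij; have := dist_gt0 pC ij; apply: contraTneq => s0.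
by rewrite -enorm_signed s0 /enorm /= expr0n addr0 sqrtr0 ltxx.
Qed.

Lemma arg_signed p i j : CONF p -> i != j -> arg (signed p i j) =
  if (i \in S) && (j \in S) then alpha p i j + cpi R else alpha p i j.
Proof.
move=> pC ij; rewrite /signed; case: ifP => // _; rewrite argN// subr_eq0.
by apply: contra ij => /eqP/pC->.
Qed.

Lemma reflect_at_perturb i j (U : set (circle R)) : nbhs (0 : circle R) U ->
  i != j ->
  F (fun p => q p j - q p i != 0 /\ U (arg (signed p i j) - alpha (q p) i j)).
Proof.
move=> /arg_perturb[e e0 eP] ij.
apply: filterS2 FC (reflect_at_near i j e0) => p pC pe.
have := eP _ _ (signed_neq0 pC ij); rewrite enorm_signed => /(_ _ pe).
by rewrite addrC subrK.
Qed.

Lemma alpha_reflect_cvg (e : pair_idx n) :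
  (fun p => alpha (q p) (val e).1 (val e).2) @ F --> (flip_angles S y).1 e.
Proof.
have ij : (val e).1 != (val e).2 by rewrite -val_eqE /= ltn_eqF// (valP e).
move: ij (alpha_cvg Fy (e := e)); rewrite /flip_angles /=.
set i := (val e).1; set j := (val e).2 => ij ac.
have sc : (fun p => arg (signed p i j)) @ F -->
    (if (i \in S) && (j \in S) then y.1 e + cpi R else y.1 e).
  apply: (@near_eq_cvg_to _ _ _ _ (fun p =>
      if (i \in S) && (j \in S) then alpha p i j + cpi R else alpha p i j));
    last first.
    by apply: filterS FC => p pC; exact/esym/arg_signed.
  case: ifP => _ //; rewrite -[cpi R]opprK; apply: cvg_circleB => //.
  exact: cvg_cst.
have dc : (fun p => arg (signed p i j) - alpha (q p) i j) @ F --> (0 :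
  circle R).
  move=> U nU.
  suff : F (fun p => U (arg (signed p i j) - alpha (q p) i j)) by [].
  by apply: filterS (reflect_at_perturb nU ij) => p [].
apply: (@near_eq_cvg_to _ _ _ _
  (fun p => arg (signed p i j) - (arg (signed p i j) - alpha (q p) i j))).
  by rewrite -[X in _ --> X]subr0; exact: cvg_circleB.
by apply: nearW => p; rewrite opprB addrCA subrr addr0.
Qed.

Lemma dist_reflect_cvg i j : i != j ->
  (fun p => enorm (q p j - q p i) / dist p i j) @ F --> (1 : R).
Proof.
move=> ij; apply/cvgrPdist_le => e e0.
apply: filterS2 FC (reflect_at_near i j e0) => p pC pe.
have d0 := dist_gt0 pC ij.
rewrite -[1](@divff _ (dist p i j)) ?gt_eqF// -mulrBl normrM normfV.
rewrite (gtr0_norm d0) ler_pdivrMr// ler_norml.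
have := ler_enormB (signed p i j) (q p j - q p i - signed p i j).
have := ler_enormD (signed p i j) (q p j - q p i - signed p i j).
rewrite [signed p i j + _]addrC subrK enorm_signed => h1 h2.
by apply/andP; split; lra.
Qed.

Lemma beta_reflect_cvg (t : triple_idx n) :
  (fun p => (beta (q p) (val t).1.1 (val t).1.2 (val t).2)%:E) @ F -->
  val (y.2 t).
Proof.
case: (and3P (valP t)) => ij ik _.
move: ij ik (beta_cvg Fy (t := t)).
set i := (val t).1.1; set j := (val t).1.2; set k := (val t).2 => ij ik bc.
pose ratio p a b := enorm (q p b - q p a) / dist p a b.
have rc : (fun p => ratio p i k / ratio p i j) @ F --> (1 : R).
  rewrite -[1 in X in _ --> X](@divr1 R 1); apply: cvgM.
    exact: dist_reflect_cvg.
  by apply: cvgV; [exact: oner_neq0|exact: dist_reflect_cvg].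
have rcE : (fun p => (ratio p i k / ratio p i j)%:E) @ F --> (1 : R)%:E.
  by apply: cvg_EFin => //; exact: nearW.
(* The limit ratio may be infinite, so the product of limits is taken in the extended reals; a
   factor 1 keeps it defined. *)
have def1 : (val (y.2 t) *? 1%:E)%E.
  by case: (val (y.2 t)) => *; rewrite /mule_def /= ?onee_eq0 ?orbT.
apply: (@near_eq_cvg_to _ _ _ _ (fun p =>
  (beta p i j k)%:E * (ratio p i k / ratio p i j)%:E)%E).
  by rewrite -[X in _ --> X]mule1; exact: cvgeM def1 bc rcE.
apply: filterS FC => p pC /=.
rewrite -EFinM; congr EFin; rewrite /beta /ratio.
rewrite -(enormN (q p i - q p k)) -(enormN (q p i - q p j)) !opprB.
rewrite -/(dist p i j) -/(dist p i k).
have d1 := dist_gt0 pC ij; have d2 := dist_gt0 pC ik.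
rewrite invfM invrK; move: (enorm (q p j - q p i))^-1 => z.
by field; rewrite !gt_eqF.
Qed.

(** Each difference is eventually nonzero, being a small perturbation of a nonzero vector, and there
    are finitely many pairs. *)
Lemma reflect_at_CONF : F (fun p => CONF (q p)).
Proof.
have : F (fun p => forall ij : 'I_n * 'I_n,
    ij.1 != ij.2 -> q p ij.2 - q p ij.1 != 0).
  apply: filter_forall => -[i j] /=.
  have [->|ij] := eqVneq i j; first exact: nearW.
  by apply: filterS (reflect_at_perturb filterT ij) => p [].
apply: filterS => p H i j qij; apply/eqP; apply: contraT => ij.
by have := H (i, j) ij; rewrite /= qij subrr eqxx.
Qed.

Lemma reflect_at_cvg : (fun p => FM_emb (q p)) @ F --> flip_angles S y.
Proof.
have h1 : (fun p => (FM_emb (q p)).1) @ F --> (flip_angles S y).1.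
  by apply: ptws_cvg => e; exact: alpha_reflect_cvg.
have h2 : (fun p => (FM_emb (q p)).2) @ F --> (flip_angles S y).2.
  by apply: ptws_cvg => t; apply: cvg_halfline; exact: beta_reflect_cvg.
exact: (cvg_pair h1 h2).
Qed.

End Limit.

Lemma FM_flip S y : FM R n y -> S \in clusters (FM_AH y) ->
  FM R n (flip_angles S y).
Proof.
move=> yF Sy; have [F [FF FC Fy]] := FM_filter yF.
have [r rS] : exists r, r \in S.
  have /(clustersP (FM_cluster_closed yF))[i [j ->]] := Sy.
  by exists i; exact: mem_pair_clusterl.
move=> U nU.
have FU : F (fun p => U (FM_emb (reflect_at r S p))).
  exact: (reflect_at_cvg rS FC Fy Sy nU).
have Fq : F (fun p => CONF (reflect_at r S p)).
  exact: (reflect_at_CONF rS FC Fy Sy).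
have [p [_ pU pC]] := CONF_near_ex FC FU Fq.
by exists (FM_emb (reflect_at r S p)); split => //; exists (reflect_at r S p).
Qed.

(** The flip changes the angle of h^{ik}_{ij} only if i and exactly one of j, k lie in S. The ratio
    is then 0 or infinite, hence equal to its opposite, and the change by pi is absorbed in the
    Klein bottle. *)
Lemma FM_AH_flip S y : FM R n y -> S \in clusters (FM_AH y) ->
  FM_AH (flip_angles S y) = FM_AH y.
Proof.
move=> yF Sy; have [F [FF FC Fy]] := FM_filter yF.
congr pair; apply/funext.
  by move=> e /=; case: ifP => // _; rewrite mod_piDpi.
move=> t; apply/eqP/hook_classP; rewrite !FM_hookE.
have sub k l : k \in S -> l \in S -> pair_cluster (FM_AH y) k l \subset S.
  exact: (pair_cluster_sub (FM_cluster_closed yF) Sy).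
have [ij ik jk] := and3P (valP t); rewrite !FM_angle_flip//.
rewrite -[(flip_angles S y).2]/y.2.
have ltoo : (val (y.2 t) < +oo)%E =
    ((val t).2 \in pair_cluster (FM_AH y) (val t).1.1 (val t).1.2).
  exact: (ratio_lt_pinfty FC Fy).
move: ltoo (mem_pair_cluster_triple y t) ij ik jk.
move: (val t).1.1 (val t).1.2 (val t).2 => i j k ltoo gt0 ij ik jk.
have [iS|iS] := boolP (i \in S); last by left.
have [jS|jS] := boolP (j \in S); have [kS|kS] := boolP (k \in S) => /=.
- by left; rewrite opprD addrACA subrr addr0.
(* Here k lies outside S while i and j lie inside, so the ratio is infinite. *)
- right; congr pair; last by rewrite /= opprD -!addrA addNr addr0.
  have : ~~ (val (y.2 t) < +oo)%E.
    rewrite ltoo; apply: contra kS.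
    by apply: fintype.subsetP; exact: sub.
  rewrite ltNge leye_eq negbK /P1_opp /P1_of_halfline => /eqP ->.
  by [].
(* Here j lies outside S while i and k lie inside, so the ratio is 0. *)
- right; congr pair; last first.
    by rewrite /= -[RHS]addrA addrACA cpiD addr0.
  have : ~~ (0 < val (y.2 t))%E.
    rewrite -gt0; apply: contra jS.
    by apply: fintype.subsetP; exact: sub.
  rewrite lt0e (_ : (0 <= val (y.2 t))%E) ?andbT; last first.
    by have := valP (y.2 t); rewrite inE.
  by rewrite negbK /P1_opp /P1_of_halfline => /eqP -> /=; rewrite oppr0.
- by left.
Qed.

End Flip.

(** * The fibre *)

Lemma card_le_inj (T U : Type) (A : set T) (B : set U) (f : T -> U) :
  (forall a, A a -> B (f a)) -> {in A &, injective f} -> (A #<= B)%card.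
Proof.
move=> fAB finj; rewrite -(card_le_eql (inj_card_eq finj)).
by apply: subset_card_le => _ [a Aa <-]; exact: fAB.
Qed.

(** The half turn has order exactly two, so its multiples remember parity. *)
Lemma odd_cpi_mul (R : realType) (a b : nat) : cpi R *+ a = cpi R *+ b ->
  odd a = odd b.
Proof.
have E m : cpi R *+ m = cpi R *+ odd m.
  rewrite -[in LHS](odd_double_half m) mulrnDr -mul2n mulrnA mulr2n cpiD.
  by rewrite mul0rn addr0.
rewrite (E a) (E b); case: (odd a) (odd b) => -[] //= /eqP.
  by rewrite mulr1n (negbTE (cpi_neq0 R)).
by rewrite eq_sym mulr1n (negbTE (cpi_neq0 R)).
Qed.

Section Fiber.
Variables (R : realType) (n : nat) (y0 : FM_ambient R n).
Hypothesis y0F : FM R n y0.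
Local Notation x := (FM_AH y0).
Local Notation C := (pair_cluster x).
Implicit Types (i j k l : 'I_n) (y : FM_ambient R n) (S : {set 'I_n}).
Implicit Types (e : pair_idx n) (A B : {set {set 'I_n}}).

Let Csub := FM_cluster_closed y0F.
Let Ctotal := FM_cluster_total y0F.

Lemma fiber_ratio y : FM_AH y = x -> y.2 = y0.2.
Proof.
move=> yx; apply/funext => t; apply: val_inj.
by rewrite -[LHS]abs_ratio_FM yx abs_ratio_FM.
Qed.

Lemma fiber_angle y e : FM_AH y = x -> y.1 e != y0.1 e -> y.1 e = y0.1 e + cpi
  R.
Proof.
move=> yx; have : mod_pi (y0.1 e) = mod_pi (y.1 e).
  exact: (esym (congr1 (fun z : AH R n => z.1 e) yx)).
by move=> /mod_pi_eq[-> /eqP|->].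
Qed.

(* Only meaningful for distinct labels: FM_angle y i i is junk. *)
Definition same_angle y i j := FM_angle y i j == FM_angle y0 i j.

Lemma same_angleC y i j : i != j -> same_angle y i j = same_angle y j i.
Proof.
move=> ij; rewrite /same_angle !(FM_angleC _ ij).
by apply/eqP/eqP => [->|/addIr].
Qed.

(** Equal clusters put the ratio of h^{ik}_{ij} in (0, oo). The flipped representative would have a
    negative ratio, so y and y0 have the same hook angle alpha_ik - alpha_ij. *)
Lemma same_angle_hook y i j k : FM_AH y = x -> i != j -> i != k ->
  C i j = C i k -> same_angle y i j = same_angle y i k.
Proof.
move=> yx ij ik CE; have [<-//|jk] := eqVneq j k.
have tP : [&& i != j, i != k & j != k] by rewrite ij ik jk.
pose t : triple_idx n := exist _ (i, j, k) tP.
have [F [FF FC Fy]] := FM_filter y0F.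
have ltoo : (val (y0.2 t) < +oo)%E = (k \in C i j).
  exact: (ratio_lt_pinfty FC Fy t).
have gt0 : (0 < val (y0.2 t))%E = (j \in C i k).
  exact/esym/(mem_pair_cluster_triple y0 t).
rewrite {1}CE mem_pair_clusterr in ltoo.
rewrite -CE mem_pair_clusterr in gt0.
have : hook_class (FM_hook y t) == hook_class (FM_hook y0 t).
  exact/eqP/(congr1 (fun z : AH R n => z.2 t) yx).
move=> /hook_classP; rewrite !FM_hookE (fiber_ratio yx) /same_angle.
move=> [[]|[]].
- move=> E; apply/eqP/eqP => H.
    by move: E; rewrite H => /addIr ->.
  by move: E; rewrite H => /addrI/oppr_inj ->.
- rewrite /P1_of_halfline; case: (val (y0.2 t)) gt0 ltoo => [r||] //.
  rewrite lte_fin => r0 _ /= [] rr _.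
  by move: (r0); rewrite {1}rr oppr_gt0 => /(lt_trans r0); rewrite ltxx.
Qed.

Lemma same_angle_cluster y i j k l : FM_AH y = x -> i != j -> k != l ->
  C i j = C k l -> same_angle y i j = same_angle y k l.
Proof.
move=> yx.
have Cpair a b c : c \in C a b -> b \in C c a -> C a b = C c a.
  move=> cab bca; apply/eqP; rewrite finset.eqEsubset.
  by rewrite !Csub ?mem_pair_clusterl ?mem_pair_clusterr.
(* One endpoint is changed at a time, from (a, b) through (a, k) to (k, l). The condition on b
   ensures that a and k span the same cluster; [Ctotal] provides it for one of the two orders of i
   and j. *)
have step a b : a != b -> k != l -> C a b = C k l -> b \in C k a ->
    same_angle y a b = same_angle y k l.
  move=> ab kl abkl bka.
  have [ak|ak] := eqVneq a k; first by subst a; exact: same_angle_hook.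
  have kab : k \in C a b by rewrite abkl mem_pair_clusterl.
  have abka := Cpair _ _ _ kab bka.
  rewrite (@same_angle_hook y a b k)//;
    last by rewrite abka (pair_clusterC Csub).
  rewrite same_angleC//; apply: same_angle_hook; rewrite // 1?eq_sym//.
  by rewrite -abka.
move=> ij kl ijkl; have /orP[h|h] := Ctotal k i j; first exact: step.
rewrite same_angleC//; apply: step; rewrite // 1?eq_sym//.
by rewrite (pair_clusterC Csub).
Qed.

Lemma FM_angle_pair y e : FM_angle y (val e).1 (val e).2 = y.1 e.
Proof.
rewrite /FM_angle; case: insubP => [e' _ ee'|].
  by congr (y.1 _); apply: val_inj; rewrite ee' -surjective_pairing.
by rewrite /= (valP e).
Qed.

Lemma pair_idx_neq e : (val e).1 != (val e).2.
Proof. by rewrite -val_eqE /= ltn_eqF// (valP e). Qed.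

Definition edge_cluster e : {set 'I_n} := C (val e).1 (val e).2.

Lemma edge_cluster_big e : edge_cluster e \in big_clusters x.
Proof.
rewrite inE; apply/andP; split.
  by apply/(clustersP Csub); exists (val e).1, (val e).2.
have : (#|[set (val e).1; (val e).2]%SET| <= #|edge_cluster e|)%N.
  apply/subset_leq_card/fintype.subsetP => k; rewrite !inE.
  by move=> ->; rewrite orbT.
by rewrite cards2 pair_idx_neq.
Qed.

Lemma big_clusterP S : S \in big_clusters x -> exists e, S = edge_cluster e.
Proof.
rewrite inE => /andP[/(clustersP Csub)[i [j ->]]].
case: (ltngtP i j) => [ij|ji|/val_inj ->].
- by exists (exist _ (i, j) ij).
- by exists (exist _ (j, i) ji); rewrite /edge_cluster /= (pair_clusterC Csub).
- by rewrite pair_clusterid cards1.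
Qed.

(** The clusters on which y differs from y0 by a half turn. For y in the fibre a single edge decides
    for all edges spanning the same cluster. *)
Definition fiber_code y : {set {set 'I_n}} :=
  finset.finset (fun S =>
    [exists e, (edge_cluster e == S) && (y.1 e != y0.1 e)]).

Lemma edge_cluster_fiber_code y e : FM_AH y = x ->
  (edge_cluster e \in fiber_code y) = (y.1 e != y0.1 e).
Proof.
move=> yx; rewrite inE; apply/existsP/idP => [[e' /andP[/eqP ee']]|H].
  rewrite -!FM_angle_pair => /negbTE h.
  have := same_angle_cluster yx (pair_idx_neq e') (pair_idx_neq e) ee'.
  by rewrite /same_angle h => /esym/negbT.
by exists e; rewrite eqxx.
Qed.

Lemma fiber_code_inj y y' : FM_AH y = x -> FM_AH y' = x ->
  fiber_code y = fiber_code y' -> y = y'.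
Proof.
move=> yx y'x E; rewrite [y]surjective_pairing [y']surjective_pairing.
rewrite (fiber_ratio yx) (fiber_ratio y'x); congr pair; apply/funext => e.
have := edge_cluster_fiber_code e y'x.
rewrite -E edge_cluster_fiber_code//.
have [->|/(fiber_angle yx) ->] := eqVneq (y.1 e) (y0.1 e).
  by move=> /esym/negbT/negPn/eqP.
by move=> /esym/(fiber_angle y'x) ->.
Qed.

Lemma fiber_code_sub y : fiber_code y \in powerset (big_clusters x).
Proof.
rewrite powersetE; apply/fintype.subsetP => S; rewrite inE.
by move=> /existsP[e /andP[/eqP <- _]]; exact: edge_cluster_big.
Qed.

(** * Realising sets of clusters by flips *)

Definition flip_all (s : seq {set 'I_n}) : FM_ambient R n :=
  foldr (@flip_angles R n) y0 s.

(** A flip preserves the image in AH and therefore the clusters, so flips can be iterated. *)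
Lemma flip_allP s : {subset s <= big_clusters x} ->
  FM R n (flip_all s) /\ FM_AH (flip_all s) = x.
Proof.
elim: s => [//|S s IH] sub.
have [sF sx] : FM R n (flip_all s) /\ FM_AH (flip_all s) = x.
  by apply: IH => T Ts; apply: sub; rewrite inE Ts orbT.
have Sx : S \in clusters (FM_AH (flip_all s)).
  by rewrite sx; have := sub S; rewrite !inE eqxx => /(_ isT)/andP[].
by split; [exact: FM_flip|rewrite [LHS]FM_AH_flip].
Qed.

Lemma flip_all_angle s e : (flip_all s).1 e =
  y0.1 e + cpi R *+ count (fun S => ((val e).1 \in S) && ((val e).2 \in S)) s.
Proof.
elim: s => [|S s IH]; first by rewrite /= mulr0n addr0.
rewrite [LHS]/= -/(flip_all s) IH /=; case: ifP => _; last by rewrite add0n.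
by rewrite add1n mulrSr addrA.
Qed.

Lemma flip_all_inj A B : A \subset big_clusters x -> B \subset big_clusters x ->
  flip_all (enum A) = flip_all (enum B) -> A = B.
Proof.
move=> AK BK E; apply/eqP; apply: contraT => AB.
(* A largest set S on which A and B differ spans an edge whose numbers of flips
   under A and B differ by exactly one. *)
pose D S := (S \in A) != (S \in B).
have [S0 DS0] : exists S, D S.
  apply/existsP; apply: contraT => /existsPn h.
  by case/eqP: AB; apply/finset.setP => S; apply/eqP; have := h S;
    rewrite /D negbK.
case: (@arg_maxnP _ S0 D (fun S => #|S|) DS0) => S DS Smax.
have SK : S \in big_clusters x.
  by move: DS; rewrite /D; have [/(fintype.subsetP AK)//|_] := boolP (S \in A);
    have [/(fintype.subsetP BK)//|_] := boolP (S \in B).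
have [e Se] := big_clusterP SK.
pose P (T : {set 'I_n}) := ((val e).1 \in T) && ((val e).2 \in T).
(* The endpoints of e span S, so a cluster containing both contains S. *)
have PE T : T \in big_clusters x -> P T = (S \subset T).
  rewrite inE => /andP[Tx _]; apply/andP/fintype.subsetP => [[h1 h2]|h].
    by apply/fintype.subsetP; rewrite Se; exact: (pair_cluster_sub Csub).
  by split; apply: h; rewrite Se ?mem_pair_clusterl ?mem_pair_clusterr.
have cnt (A' : {set {set 'I_n}}) : count P (enum A') =
    ((S \in A') + count (fun T => P T && (T != S)) (enum A'))%N.
  rewrite -!sum1_count !big_enum_cond/=.
  have [SA|SA] := boolP (S \in A').
    rewrite (bigD1 S) /=; first by congr (_ + _)%N; apply: eq_bigl => T;
      rewrite andbA.
    by rewrite SA PE ?subxx.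
  rewrite add0n; apply: eq_bigl => T; have [->|] := eqVneq T S.
    by rewrite (negbTE SA).
  by rewrite andbT.
(* The other clusters counted strictly contain S, and S is a largest one on which A and B differ. *)
have same T : P T && (T != S) -> (T \in A) = (T \in B).
  move=> /andP[PT TS]; apply/eqP; apply: contraT => DT.
  have TK : T \in big_clusters x.
    by move: DT; have [/(fintype.subsetP AK)//|_] := boolP (T \in A);
      have [/(fintype.subsetP BK)//|_] := boolP (T \in B).
  have : (#|T| <= #|S|)%N by apply: Smax.
  rewrite leqNgt proper_card//; rewrite PE// in PT.
  by rewrite finset.properEneq PT andbT eq_sym.
have : (flip_all (enum A)).1 e = (flip_all (enum B)).1 e by rewrite E.
rewrite !flip_all_angle => /addrI/odd_cpi_mul; rewrite !cnt.
have -> : count (fun T => P T && (T != S)) (enum A) =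
          count (fun T => P T && (T != S)) (enum B).
  rewrite -!sum1_count !big_enum_cond/=; apply: eq_bigl => T.
  have [h|] := boolP (P T && (T != S)); last by rewrite !andbF.
  by rewrite (same T h).
rewrite !oddD => /addIb; rewrite !oddb => h.
by move: DS; rewrite /D h eqxx.
Qed.

End Fiber.

Theorem theorem7p65 (R : realType) (n : nat) (n_ge2 : (2 <= n)%N)
    (x : XAH R n) :
  (@FM_to_XAH R n @^-1` [set x] #= `I_(2 ^ #|zero_ratios (val x)|.+1))%card.
Proof.
have [y0 y0F y0x] := FM_to_XAH_surj (set_mem (valP x)).
have fiberP (z : FM R n) : FM_to_XAH z = x <-> FM_AH (val z) = FM_AH y0.
  rewrite y0x; split=> [<-//|zx]; exact: val_inj.
have -> : #|zero_ratios (val x)|.+1 = #|big_clusters (FM_AH y0)|.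
  rewrite -y0x; apply: card_zero_ratios => //.
    exact: FM_cluster_closed.
  exact: FM_cluster_total.
set K := big_clusters _.
pose sets := enum (powerset K).
have sizeE : size sets = (2 ^ #|K|)%N by rewrite -cardE card_powerset.
(* One injection sends a point of the fibre to the position of its code among the subsets of K; the
   other flips y0 along the subset at a given position. *)
apply: Cantor_Bernstein.
  apply: (@card_le_inj _ _ _ _ (fun z : FM R n =>
    index (fiber_code y0 (val z)) sets)).
    move=> z _; rewrite /= -sizeE index_mem mem_enum; exact: fiber_code_sub.
  move=> z z' /set_mem/fiberP zx /set_mem/fiberP z'x E; apply: val_inj.
  apply: (fiber_code_inj y0F zx z'x).
  have mem w : fiber_code y0 w \in sets by rewrite mem_enum; exact:
    fiber_code_sub.
  have := congr1 (nth finset.set0 sets) E.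
  by rewrite /= !nth_index ?(mem (val z)) ?(mem (val z')).
(* The default y0 of [insubd] is never taken: every position, even one out of range where [nth]
   returns the empty set, yields a subset of K, and flipping along it stays in FM. *)
pose lift k : FM R n := insubd (exist _ y0 (mem_set y0F))
  (flip_all y0 (enum (nth finset.set0 sets k))).
have subK k : {subset enum (nth finset.set0 sets k) <= K}.
  move=> S; rewrite mem_enum; apply/fintype.subsetP.
  have [kl|kg] := ltnP k (size sets).
    by have := mem_nth finset.set0 kl; rewrite mem_enum powersetE.
  by rewrite nth_default// finset.sub0set.
have liftE k : val (lift k) = flip_all y0 (enum (nth finset.set0 sets k)).
  by rewrite /lift insubdK//; apply/mem_set; have [] := flip_allP y0F (subK k).
apply: (@card_le_inj _ _ _ _ lift).
  move=> k _; apply/fiberP; rewrite liftE.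
  by have [] := flip_allP y0F (subK k).
move=> k k' /set_mem kI /set_mem k'I /(congr1 val); rewrite !liftE => E.
have kE : nth finset.set0 sets k = nth finset.set0 sets k'.
  apply: (flip_all_inj y0F _ _ E); apply/fintype.subsetP => S;
    rewrite -mem_enum; exact: subK.
have ks : (k < size sets)%N by rewrite sizeE.
have k's : (k' < size sets)%N by rewrite sizeE.
by apply/eqP; rewrite -(nth_uniq finset.set0 ks k's (enum_uniq _)) kE.
Qed.
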